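(* Let $(\mathbf{i},\mathbf{a})$ and $(\mathbf{i}',\mathbf{a}')$ be pairs of sequences of weight $\mathbf{v}\in\mathbb{N}[I]$. Then $$(E_{\mathbf{i},\mathbf{a}},E_{\mathbf{i}',\mathbf{a}'})=v^{-\dim R_{\mathbf{i},\mathbf{a}}-\dim R_{\mathbf{i}',\mathbf{a}'}}\,\frac{\prod_{i\in I}(1-v^{-2})^{-\mathbf{v}_i}}{[\mathbf{a}]!\,[\mathbf{a}']!}\sum_{w\in S_{\mathbf{v}}}v^{2\left(l(w)+\dim (R_{\mathbf{i},\mathbf{a}}\cap{}^{w}R_{\mathbf{i}',\mathbf{a}'})\right)}.$$
   Context: Quantum group. Let $\Phi$ be a simply-laced (finite ADE) root system with simple roots $\mathbf{e}_i$ ($i\in I$). $U^+$ is the $\mathbb{Q}(v)$-algebra with generators $E_i$ ($i\in I$) and relations $E_iE_j=E_jE_i$ if $\langle\mathbf{e}_i,\check{\mathbf{e}}_j\rangle=0$ and $E_i^2E_j-(v+v^{-1})E_iE_jE_i+E_jE_i^2=0$ if $\langle\mathbf{e}_i,\check{\mathbf{e}}_j\rangle=-1$. It is graded, $U^+=\bigoplus_{\mathbf{v}\in\mathbb{N}[I]}U^+_{\mathbf{v}}$, with $E_i$ in degree $i$; $\mathbb{N}$ contains $0$. Write $[k]!=\prod_{j=1}^k\frac{v^j-v^{-j}}{v-v^{-1}}$ and $x^{(k)}=x^k/[k]!$. Bilinear form. Let $\cdot$ be the symmetric form on $\mathbb{Z}[I]$ given by the Cartan matrix ($i\cdot j=\langle\mathbf{e}_i,\check{\mathbf{e}}_j\rangle$).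 Equip $U^+\otimes U^+$ with the twisted product $(x_1\otimes x_2)(y_1\otimes y_2)=v^{|x_2|\cdot|y_1|}x_1y_1\otimes x_2y_2$ for homogeneous elements, where $|x|$ is the degree. Let $r:U^+\to U^+\otimes U^+$ be the algebra homomorphism with $r(E_i)=E_i\otimes1+1\otimes E_i$. The standard bilinear form $(\cdot,\cdot):U^+\times U^+\to\mathbb{Q}(v)$ (Lusztig) is the unique symmetric bilinear form with $(1,1)=1$, $(E_i,E_j)=\delta_{ij}(1-v^{-2})^{-1}$ and $(x,yy')=(r(x),y\otimes y')$, where $(x\otimes x',y\otimes y'):=(x,y)(x',y')$. Monomials. For $\mathbf{i}=(i_1,\dots,i_m)\in I^m$ and $\mathbf{a}=(a_1,\dots,a_m)\in\mathbb{N}^m$, the pair $(\mathbf{i},\mathbf{a})$ has weight $\mathbf{v}$ if $\mathbf{v}_j=\sum_{i_k=j}a_k$ for all $j\in I$. Then $E_{\mathbf{i},\mathbf{a}}:=E_{i_1}^{(a_1)}\cdots E_{i_m}^{(a_m)}\in U^+_{\mathbf{v}}$ and $[\mathbf{a}]!:=[a_1]!\cdots[a_m]!$. The two pairs may have different lengths $m$. Quiver. Fix an orientation of the Dynkin diagram of $\Phi$ (any orientation). $R_{\mathbf{v}}=\bigoplus_{i\to j}\mathrm{Hom}(\mathbb{C}^{\mathbf{v}_i},\mathbb{C}^{\mathbf{v}_j})$ is the space of $\mathbf{v}$-dimensional representations, acted on by $GL_{\mathbf{v}}=\prod_{i\in I}GL_{\mathbf{v}_i}$ by change of basis. Fix a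 Borel subgroup $B\subset GL_{\mathbf{v}}$ and a maximal torus $T\subset B$. $S_{\mathbf{v}}=\prod_{i}S_{\mathbf{v}_i}$ is the Weyl group, $l$ its length function (with respect to $B$). There is a unique $B$-stable flag $F^*$ of $I$-graded subspaces $\mathbb{C}^{\mathbf{v}}=F^0\supset F^1\supset\dots\supset F^m=\{0\}$ of type $(\mathbf{i},\mathbf{a})$, i.e. $F^{k-1}/F^k$ is concentrated in degree $i_k$ and has dimension $a_k$. $R_{\mathbf{i},\mathbf{a}}\subset R_{\mathbf{v}}$ is the subspace of all representations $x$ with $x(F^k)\subset F^k$ for all $k$. For $w\in S_{\mathbf{v}}$, ${}^wR_{\mathbf{i},\mathbf{a}}:=\dot w\cdot R_{\mathbf{i},\mathbf{a}}$ for a lift $\dot w\in N_{GL_{\mathbf{v}}}(T)$ of $w$. *)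

(* Defs.v *)
From HB Require Import structures.
From mathcomp Require Import all_boot all_order all_algebra all_fingroup.
From mathcomp Require Import reals complex.

Set Implicit Arguments.
Unset Strict Implicit.
Unset Printing Implicit Defensive.

Import Order.TTheory GRing.Theory Num.Theory.
Local Open Scope ring_scope.

Section RootSystem.
Variables (R : realType) (n : nat).
Implicit Types (Phi : seq 'rV[R]_n) (x y : 'rV[R]_n).

Definition dotv x y : R := (x *m y^T) 0 0.

(* the pairing <x, y^vee> of x with the coroot of y *)
Definition copair x y : R := 2 * dotv x y / dotv y y.

Definition root_system Phi : Prop :=
  [/\ 0 \notin Phi,
      <<Phi>>%VS = fullv,
      {in Phi &, forall x y, x - copair x y *: y \in Phi},
      {in Phi &, forall x y, copair x y \is a Num.int} &
      {in Phi, forall x c, c *: x \in Phi -> c = 1 \/ c = -1}].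

Variable I : finType.
Implicit Type e : I -> 'rV[R]_n.

Definition simple_roots Phi e : Prop :=
  [/\ forall i, e i \in Phi,
      free (codom e) &
      {in Phi, forall x, exists c : I -> nat,
        x = \sum_i (c i)%:R *: e i \/ x = - \sum_i (c i)%:R *: e i}].

Definition simply_laced e : Prop :=
  forall i j, i != j -> copair (e i) (e j) = 0 \/ copair (e i) (e j) = -1.

(* For roots, copair is an integer, so floor only changes its type. *)
Definition cartan e (i j : I) : int := Num.floor (copair (e i) (e j)).

End RootSystem.

Definition Qv : fieldType := {fraction {poly rat}}.
Definition vv : Qv := tofrac ('X : {poly rat}).

Definition qint (k : nat) : Qv := (vv ^+ k - vv ^- k) / (vv - vv^-1).
Definition qfact (k : nat) : Qv := \prod_(1 <= j < k.+1) qint j.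

Section QuantumGroup.
Variables (I : finType) (c : I -> I -> int).

Definition serre (A : algType Qv) (x : I -> A) : Prop :=
  (forall i j, c i j = 0 -> x i * x j = x j * x i) /\
  (forall i j, c i j = -1 ->
     x i ^+ 2 * x j - (vv + vv^-1) *: (x i * x j * x i) + x j * x i ^+ 2 = 0).

(* (U, E) is the algebra with generators E and the relations above, i.e. the
   universal algebra with a family of elements satisfying them. *)
Definition is_Uplus (U : algType Qv) (E : I -> U) : Prop :=
  serre E /\
  forall (A : algType Qv) (x : I -> A), serre x ->
    exists f : {lrmorphism U -> A},
      (forall i, f (E i) = x i) /\
      forall g : {lrmorphism U -> A}, (forall i, g (E i) = x i) -> g =1 f.

Definition wt (s : seq I) (i : I) : nat := count_mem i s.

(* x lies in the graded piece U^+_nu, spanned by the words in E of weight nu *)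
Definition homog (U : algType Qv) (E : I -> U) (nu : I -> nat) (x : U) : Prop :=
  exists2 s : seq (Qv * seq I),
    forall p, p \in s -> wt p.2 =1 nu &
    x = \sum_(p <- s) p.1 *: \prod_(i <- p.2) E i.

Definition dotw (nu mu : I -> nat) : int :=
  \sum_i \sum_j (nu i)%:Z * (mu j)%:Z * c i j.

Definition divpow (U : algType Qv) (x : U) (k : nat) : U :=
  (qfact k)^-1 *: x ^+ k.

Definition Emon (U : algType Qv) (E : I -> U) m (ii : 'I_m -> I)
    (a : 'I_m -> nat) : U :=
  \prod_(k < m) divpow (E (ii k)) (a k).

Definition has_weight m (ii : 'I_m -> I) (a : 'I_m -> nat) (v : I -> nat) :=
  forall j, v j = (\sum_(k < m | ii k == j) a k)%N.

(* T, with t x y standing for the tensor x (x) y, is the tensor product U (x) U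
   of Qv-modules. *)
Definition is_tensor (U T : lmodType Qv) (t : {bilinear U -> U -> T}) : Prop :=
  forall (W : lmodType Qv) (h : {bilinear U -> U -> W}),
    exists f : {linear T -> W},
      (forall x y, f (t x y) = h x y) /\
      forall g : {linear T -> W}, (forall x y, g (t x y) = h x y) -> g =1 f.

(* The degrees of x1 and y2 do not enter, so these need not be homogeneous. *)
Definition twisted_mul (U T : algType Qv) (E : I -> U)
    (t : {bilinear U -> U -> T}) : Prop :=
  forall (nu mu : I -> nat) (x1 x2 y1 y2 : U),
    homog E nu x2 -> homog E mu y1 ->
    t x1 x2 * t y1 y2 = vv ^ dotw nu mu *: t (x1 * y1) (x2 * y2).

Definition lusztig_form (U T : algType Qv) (E : I -> U)
    (t : {bilinear U -> U -> T}) (r : U -> T) (B : {biscalar U}) : Prop :=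
  [/\ forall x y, B x y = B y x,
      B 1 1 = 1,
      forall i j, B (E i) (E j) = if i == j then (1 - vv ^- 2)^-1 else 0 &
      exists BT : {biscalar T},
        (forall x x' y y', BT (t x x') (t y y') = B x y * B x' y') /\
        (forall x y y', B x (y * y') = BT (r x) (t y y'))].

End QuantumGroup.

(* arr i j means that i -> j is an arrow. *)
Definition is_orientation (I : finType) (c : I -> I -> int) (arr : rel I) :=
  (forall i j, arr i j -> c i j = -1) /\
  (forall i j, c i j = -1 -> arr i j (+) arr j i).

Section Rep.
Variables (K : fieldType) (I : finType) (arr : rel I) (v : I -> nat).

Definition arrow := {h : I * I | arr h.1 h.2}.
Definition src (h : arrow) : I := (val h).1.
Definition tgt (h : arrow) : I := (val h).2.

(* Vectors are columns; the matrix of an arrow i -> j maps K^(v i) to K^(v j). *)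
Definition rep := {dffun forall h : arrow, 'M[K]_(v (tgt h), v (src h))}.

HB.instance Definition _ := Choice.on rep.

Implicit Types x y z : rep.

Definition rep_zero : rep := [ffun h : arrow => 0 : 'M[K]_(v (tgt h), v (src h))].
Definition rep_opp x : rep := [ffun h => - x h].
Definition rep_add x y : rep := [ffun h => x h + y h].
Definition rep_scale (c : K) x : rep := [ffun h => c *: x h].

Fact rep_addA : associative rep_add.
Proof. by move=> x y z; apply/ffunP => h; rewrite !ffunE addrA. Qed.
Fact rep_addC : commutative rep_add.
Proof. by move=> x y; apply/ffunP => h; rewrite !ffunE addrC. Qed.
Fact rep_add0 : left_id rep_zero rep_add.
Proof. by move=> x; apply/ffunP => h; rewrite !ffunE add0r. Qed.
Fact rep_addN : left_inverse rep_zero rep_opp rep_add.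
Proof. by move=> x; apply/ffunP => h; rewrite !ffunE addNr. Qed.

HB.instance Definition _ :=
  GRing.isZmodule.Build rep rep_addA rep_addC rep_add0 rep_addN.

Fact rep_scaleA a b x : rep_scale a (rep_scale b x) = rep_scale (a * b) x.
Proof. by apply/ffunP => h; rewrite !ffunE scalerA. Qed.
Fact rep_scale1 : left_id 1 rep_scale.
Proof. by move=> x; apply/ffunP => h; rewrite !ffunE scale1r. Qed.
Fact rep_scaleDr : right_distributive rep_scale +%R.
Proof. by move=> a x y; apply/ffunP => h; rewrite !ffunE scalerDr. Qed.
Fact rep_scaleDl x : {morph rep_scale^~ x : a b / a + b}.
Proof. by move=> a b; apply/ffunP => h; rewrite !ffunE scalerDl. Qed.

HB.instance Definition _ := GRing.Zmodule_isLmodule.Build K rep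
  rep_scaleA rep_scale1 rep_scaleDr rep_scaleDl.

Lemma repDE x y h : (x + y) h = x h + y h. Proof. exact: ffunE. Qed.
Lemma repZE (c : K) x h : (c *: x) h = c *: x h. Proof. exact: ffunE. Qed.

Definition rep_index := {h : arrow & ('I_(v (tgt h)) * 'I_(v (src h)))%type}.

Fact rep_vect_iso : Vector.axiom #|{: rep_index}| rep.
Proof.
pose f x : 'rV[K]_#|{: rep_index}| := \row_k
  x (tag (enum_val k)) (tagged (enum_val k)).1 (tagged (enum_val k)).2.
pose g (r : 'rV[K]_#|{: rep_index}|) : rep := [ffun h : arrow =>
  \matrix_(p, q) r 0 (enum_rank (existT _ h (p, q) : rep_index))
  : 'M[K]_(v (tgt h), v (src h))].
exists f.
  by move=> c x y; apply/rowP => k; rewrite !mxE repDE repZE !mxE.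
exists g => [x|r].
  by apply/ffunP => h; apply/matrixP => p q; rewrite ffunE !mxE enum_rankK.
apply/rowP => k; rewrite mxE ffunE mxE; congr (r _ _).
by case: (enum_val k) (enum_valK k) => h [p q].
Qed.

HB.instance Definition _ := Lmodule_hasFinDim.Build K rep rep_vect_iso.

Definition GLfam := forall i, 'M[K]_(v i).
Definition inGL (g : GLfam) : Prop := forall i, g i \in unitmx.

Definition rep_act (g : GLfam) x : rep :=
  [ffun h : arrow => g (tgt h) *m x h *m invmx (g (src h))].

Fact rep_act_linear g : linear (rep_act g).
Proof.
move=> c x y; apply/ffunP => h; rewrite repDE repZE !ffunE.
by rewrite mulmxDr mulmxDl -scalemxAr -scalemxAl.
Qed.
HB.instance Definition _ g :=
  GRing.isLinear.Build K rep rep *:%R (rep_act g) (rep_act_linear g).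

(* A pair (B, T) is given by an ordered basis of each K^(v i), the columns of
   b i: B consists of the g in GL_v that are upper triangular, and T of those
   that are diagonal, in this basis. *)

Variable b : GLfam.

Definition in_basis (g : GLfam) : GLfam := fun i => invmx (b i) *m g i *m b i.

Definition borel (g : GLfam) : Prop :=
  inGL g /\ forall i (p q : 'I_(v i)), (q < p)%N -> in_basis g i p q = 0.

Definition torus (g : GLfam) : Prop :=
  inGL g /\ forall i (p q : 'I_(v i)), p != q -> in_basis g i p q = 0.

Definition torus_normalizer (g : GLfam) : Prop :=
  inGL g /\
  forall t, torus (fun i => g i *m t i *m invmx (g i)) <-> torus t.

(* I-graded subspaces of K^v are families of subspaces of the K^(v i). *)
Definition gsub := forall i, {vspace 'cV[K]_(v i)}.

Definition bstable (W : gsub) : Prop :=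
  forall g, borel g -> forall i u, u \in W i -> g i *m u \in W i.

(* F 0, ..., F m is the B-stable flag of type (ii, a); only these terms of F
   matter. *)
Definition is_flag m (ii : 'I_m -> I) (a : 'I_m -> nat) (F : nat -> gsub) :=
  [/\ forall i, F 0%N i = fullv,
      forall i, F m i = 0%VS,
      forall (k : 'I_m) i, (F k.+1 i <= F k i)%VS,
      forall (k : 'I_m) i, \dim (F k i) =
        (\dim (F k.+1 i) + (if i == ii k then a k else 0))%N &
      forall k, (k <= m)%N -> bstable (F k)].

Definition eval_col (h : arrow) (u : 'cV[K]_(v (src h))) (x : rep) :
  'cV[K]_(v (tgt h)) := x h *m u.

Fact eval_col_linear h u : linear (@eval_col h u).
Proof.
by move=> c x y; rewrite /eval_col repDE repZE mulmxDl scalemxAl.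
Qed.
HB.instance Definition _ h u := GRing.isLinear.Build K rep 'cV[K]_(v (tgt h))
  *:%R (@eval_col h u) (@eval_col_linear h u).

Definition Rflag m (F : nat -> gsub) : {vspace rep} :=
  (\bigcap_(k < m.+1) \bigcap_(h : arrow) \bigcap_(u <- vbasis (F k (src h)))
     (linfun (@eval_col h u) @^-1: F k (tgt h)))%VS.

Lemma mem_bigcapv (J : Type) (s : seq J) (P : pred J) (W : J -> {vspace rep}) x :
  (x \in (\bigcap_(j <- s | P j) W j)%VS) = all (fun j => P j ==> (x \in W j)) s.
Proof.
elim: s => [|j s IH]; first by rewrite big_nil memvf.
by rewrite big_cons /=; case: (P j) => //=; rewrite memv_cap IH.
Qed.

Lemma RflagP m F x :
  x \in Rflag m F <->
  forall k : nat, (k <= m)%N -> forall (h : arrow) u,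
    u \in F k (src h) -> x h *m u \in F k (tgt h).
Proof.
rewrite /Rflag; split=> [|H].
  rewrite mem_bigcapv => /allP Hx k km h u uF.
  have := Hx (Ordinal (km : (k < m.+1)%N)) (mem_index_enum _).
  rewrite /= mem_bigcapv => /allP/(_ h (mem_index_enum _)) /=.
  rewrite mem_bigcapv => /allP Hb.
  rewrite (coord_vbasis uF) mulmx_sumr; apply: memv_suml => j _.
  rewrite -scalemxAr; apply: memvZ.
  have := Hb _ (mem_nth 0 _) => /(_ j).
  by rewrite size_tuple => /(_ (ltn_ord j)); rewrite /= -memv_preim lfunE.
rewrite mem_bigcapv; apply/allP => k _ /=; rewrite mem_bigcapv.
apply/allP => h _ /=; rewrite mem_bigcapv; apply/allP => u uF /=.
rewrite -memv_preim lfunE /=; apply: H; first exact: (ltn_ord k).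
exact: vbasis_mem.
Qed.

(* S_v is identified with N(T)/T: w permutes the lines spanned by the basis
   vectors of K^(v i) (the weight spaces of T) as w i permutes their indices. *)
Definition is_lift (w : {dffun forall i, 'S_(v i)}) (g : GLfam) : Prop :=
  torus_normalizer g /\
  forall i (p : 'I_(v i)),
    exists c : K, g i *m col p (b i) = c *: col (w i p) (b i).

End Rep.

(* Length on S_v: the least length of a word in the simple reflections, which
   are the adjacent transpositions in the factors.  Such a word exists with
   fewer than #|S_v| letters. *)

Section Length.
Variables (I : finType) (v : I -> nat).

Definition weyl := {dffun forall i, 'S_(v i)}.

HB.instance Definition _ := Finite.on weyl.
HB.instance Definition _ := FinGroup.on weyl.

Definition simple_refl (s : weyl) : bool :=
  [exists i, exists p : 'I_(v i), exists q : 'I_(v i),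
    (q == p.+1 :> nat) && (s == dfung1 (tperm p q))].

Definition has_word (w : weyl) (n : nat) : bool :=
  [exists t : n.-tuple weyl,
    all simple_refl t && (\prod_(s <- t) s == w)%g].

Definition weyl_length (w : weyl) : nat := find (has_word w) (iota 0 #|weyl|).

End Length.

(* Main.v *)
Require Import Defs.
From mathcomp Require Import all_boot all_order all_algebra all_fingroup.
From mathcomp Require Import reals complex zify.

Import Order.TTheory GRing.Theory Num.Theory.
Local Open Scope ring_scope.

Set Implicit Arguments.
Unset Strict Implicit.
Unset Printing Implicit Defensive.

(** Both sides are sums of powers of v over the same finite set, and they agree
    term by term.

    On the quantum side, E_{i,a} is 1/[a]! times the product of the E_i along a
    word t of length N = sum of the v_i.  Applying r to a word of generators and
    splitting off one letter of the second argument at a time gives a quantum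
    shuffle formula: the form of two words is (1 - v^-2)^-N times the sum, over
    all letter-preserving bijections between them, of v to the sum of i . j over
    the inverted pairs of letters i, j ([form_word_permutations]).

    On the geometric side everything is spanned by coordinate vectors.  A
    particle is one of the basis vectors of K^v, that is, a pair (i, p) with
    p < v_i.  A word of weight v labels its letters by the particles, and so
    puts a total order on them, in such a way that the terms of the B-stable
    flag are spanned by final segments of the order ([flag_mem]).  Since a
    quiver has no arrow inside one block of equal letters, the coarse flag of
    type (i,a) and its full refinement define the same space R_{i,a}; it has a
    basis indexed by the pairs x < y of particles joined by an arrow x -> y
    ([dim_Rflag]), and translating by w permutes these basis elements
    ([dim_cap_lift]).

    Letter-preserving bijections of the particles are the elements w of S_v
    ([sum_permutations_act]).  An inverted pair of equal letters contributes
    i . i = 2 to the exponent, and these pairs are counted by the length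
    ([weyl_length_ninv]).  An inverted pair joined by an arrow contributes -1;
    these are the pairs on which the two orders disagree, and their number is
    dim R + dim R' - 2 dim (R cap wR').  All other pairs contribute 0
    ([inv_weight_act]). *)

(** * Words and the quantum shuffle formula *)

Lemma vv_neq0 : vv != 0.
Proof. by rewrite /vv tofrac_eq0 polyX_eq0. Qed.

Section Shuffle.
Variables (I : finType) (c : I -> I -> int).
Implicit Types (s t w : seq I) (i j x : I).

(** The terms (q, (w1, w2)) of r(E_s) = sum of q E_w1 (x) E_w2.  Each letter
    goes left or right, and a letter x that goes right, past the left word w1 of
    the later letters, picks up the twist v^(x . w1). *)
Fixpoint coprod s : seq (Qv * (seq I * seq I)) :=
  if s is x :: s' then
    [seq (p.1, (x :: p.2.1, p.2.2)) | p <- coprod s'] ++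
    [seq (vv ^ (\sum_(y <- p.2.1) c x y) * p.1, (p.2.1, x :: p.2.2))
      | p <- coprod s']
  else [:: (1, ([::], [::]))].

Arguments coprod : simpl never.

Lemma coprod_cons x s : coprod (x :: s) =
  [seq (p.1, (x :: p.2.1, p.2.2)) | p <- coprod s] ++
  [seq (vv ^ (\sum_(y <- p.2.1) c x y) * p.1, (p.2.1, x :: p.2.2))
    | p <- coprod s].
Proof. by []. Qed.

Lemma size_coprod s p :
  p \in coprod s -> (size p.2.1 + size p.2.2 = size s)%N.
Proof.
elim: s p => [|x s IH] p; first by rewrite inE => /eqP->.
by rewrite coprod_cons mem_cat => /orP[] /mapP[q /IH szq ->] /=;
  rewrite -szq ?addSn ?addnS.
Qed.

(** Pairing r(E_s) with E_j (x) y leaves only the part E_j (x) U; the parts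
    1 (x) U and U (x) 1 serve to show that (E_s, 1) vanishes. *)
Lemma coprod_nil_l (G : seq I -> Qv) s :
  \sum_(p <- coprod s | p.2.1 == [::]) p.1 * G p.2.2 = G s.
Proof.
elim: s G => [|x s IH] G; first by rewrite big_cons big_nil addr0 mul1r.
rewrite coprod_cons big_cat !big_map /= big_pred0_eq add0r.
rewrite -(IH (fun w => G (x :: w))).
by apply: eq_bigr => p /eqP->; rewrite big_nil expr0z mul1r.
Qed.

Lemma coprod_nil_r (G : seq I -> Qv) s :
  \sum_(p <- coprod s | p.2.2 == [::]) p.1 * G p.2.1 = G s.
Proof.
elim: s G => [|x s IH] G; first by rewrite big_cons big_nil addr0 mul1r.
rewrite coprod_cons big_cat !big_map /= big_pred0_eq addr0.
by rewrite -(IH (fun w => G (x :: w))).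
Qed.

(** The sum over the occurrences of j in s of v^(s' . j) G(s''), where s' is
    what precedes the occurrence and s'' is s without it. *)
Fixpoint extract j (G : seq I -> Qv) s : Qv :=
  if s is x :: s' then
    (if x == j then G s' else 0)
    + vv ^ c x j * extract j (fun w => G (x :: w)) s'
  else 0.

Lemma coprod_extract j G s :
  \sum_(p <- coprod s | p.2.1 == [:: j]) p.1 * G p.2.2 = extract j G s.
Proof.
elim: s G => [|x s IH] G; first by rewrite big_cons big_nil.
rewrite coprod_cons big_cat !big_map /=; congr (_ + _).
  case: eqP => [->|nxj]; last first.
    by rewrite big_pred0 // => p; rewrite eqseq_cons; case: eqP nxj.
  rewrite -[RHS]coprod_nil_l; apply: eq_bigl => p.
  by rewrite eqseq_cons eqxx.
rewrite -(IH (fun w => G (x :: w))) mulr_sumr.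
by apply: eq_bigr => p /eqP->; rewrite big_seq1 mulrA.
Qed.

Section Form.
Variables (U UU : algType Qv) (E : I -> U) (tens : {bilinear U -> U -> UU}).
Hypothesis hmul : twisted_mul c E tens.
Variable r : {lrmorphism U -> UU}.
Hypothesis hr : forall i, r (E i) = tens (E i) 1 + tens 1 (E i).
Variable form : {biscalar U}.
Hypothesis hform : lusztig_form E tens r form.

Definition word s : U := \prod_(i <- s) E i.

Lemma word_cons i s : word (i :: s) = E i * word s.
Proof. by rewrite /word big_cons. Qed.

Lemma word_nil : word [::] = 1.
Proof. by rewrite /word big_nil. Qed.

Lemma homog_word s : homog E (wt s) (word s).
Proof.
exists [:: (1, s)]; first by move=> p; rewrite inE => /eqP->.
by rewrite big_seq1 scale1r.
Qed.

Lemma dotw_wt x s : dotw c (wt [:: x]) (wt s) = \sum_(y <- s) c x y.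
Proof.
rewrite /dotw (bigD1 x) //= [X in _ + X]big1 ?addr0 => [|i nix]; last first.
  by rewrite big1 // => j _; rewrite /wt /= eq_sym (negPf nix) !mul0r.
elim: s => [|y s IH].
  by rewrite big_nil big1 // => j _; rewrite mulr0 mul0r.
rewrite big_cons -IH (bigD1 y) //= [X in _ = _ + X](bigD1 y) //= addrA.
congr (_ + _).
  by rewrite /wt /= !eqxx addn0 !mul1r PoszD mulrDl mul1r.
apply: eq_bigr => j njy.
by rewrite /wt /= [y == j]eq_sym (negPf njy) add0n.
Qed.

Lemma tens_mul_word s1 s2 t1 t2 :
  tens (word s1) (word s2) * tens (word t1) (word t2)
  = vv ^ dotw c (wt s2) (wt t1)
    *: tens (word s1 * word t1) (word s2 * word t2).
Proof. by apply: hmul; apply: homog_word. Qed.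

(** For the empty word this would identify the unit of UU with tens 1 1; a
    nonempty product already starts from a sum of tensors. *)
Lemma coproduct_word x s : r (word (x :: s)) =
  \sum_(p <- coprod (x :: s)) p.1 *: tens (word p.2.1) (word p.2.2).
Proof.
elim: s x => [|y s IH] x.
  rewrite coprod_cons word_cons word_nil mulr1 hr /= big_cons big_seq1 /=.
  rewrite big_nil expr0z.
  by rewrite mulr1 !scale1r !word_cons word_nil mulr1.
have -> : word [:: x, y & s] = E x * word (y :: s) by exact: word_cons.
rewrite [in RHS]coprod_cons.
move: (coprod (y :: s)) (IH y) => cs IHy; rewrite rmorphM /= IHy hr mulrDl.
rewrite big_cat !big_map /= !mulr_sumr.
have E1 z : E z = word [:: z] by rewrite word_cons word_nil mulr1.
congr (_ + _); apply: eq_bigr => p _; rewrite -scalerAr E1 -word_nil.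
  rewrite tens_mul_word word_nil !word_cons word_nil mulr1 mul1r.
  rewrite /dotw !big1 ?scale1r // => i _; rewrite big1 // => j _.
  by rewrite /wt /= !mul0r.
rewrite tens_mul_word dotw_wt word_nil !word_cons word_nil mulr1 mul1r.
by rewrite scalerA mulrC.
Qed.

Lemma form_word_mul x s y y' : form (word (x :: s)) (y * y') =
  \sum_(p <- coprod (x :: s))
     p.1 * (form (word p.2.1) y * form (word p.2.2) y').
Proof.
case: hform => _ _ _ [BT [hBT hB]].
rewrite hB coproduct_word linear_sumlz; apply: eq_bigr => p _.
by rewrite linearZl_LR /= hBT.
Qed.

(** Expanding (E_s, 1 * 1) by the coproduct gives (E_s, 1) twice, from the terms
    E_s (x) 1 and 1 (x) E_s, plus products that vanish by induction on the
    length; hence (E_s, 1) = 2 (E_s, 1). *)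
Lemma form_word1 s : s != [::] -> form (word s) 1 = 0.
Proof.
case: hform => _ h11 _ _.
have [n] := ubnP (size s); elim: n s => // n IH [|x s] // sz _.
pose f w := form (word w) 1.
have f2 : f (x :: s) = f (x :: s) + f (x :: s).
  have fE : f (x :: s) =
      \sum_(p <- coprod (x :: s)) p.1 * (f p.2.1 * f p.2.2).
    by rewrite -form_word_mul mulr1.
  rewrite [LHS]fE -[X in _ = X + _](coprod_nil_l f).
  rewrite -[X in _ = _ + X](coprod_nil_r f) [X in _ = X + _]big_mkcond.
  rewrite [X in _ = _ + X]big_mkcond -big_split /= !big_seq.
  apply: eq_bigr => -[a [w1 w2]] pin; have := size_coprod pin.
  rewrite [size (x :: s)]/= -/(f w1) -/(f w2) => szw.
  have IHf w : w != [::] -> (size w < (size s).+1)%N -> f w = 0.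
    by move=> w0 lw; apply: IH => //; apply: leq_trans lw sz.
  have f0 : f [::] = 1 by rewrite /f word_nil.
  case: w1 w2 szw {pin} => [|x1 w1] [|x2 w2] //= szw.
  - by rewrite f0 mul1r addr0.
  - by rewrite f0 mulr1 add0r.
  rewrite (IHf (x1 :: w1)) //= ?mul0r ?mulr0 ?addr0 //.
  by rewrite -szw addSn addnS !ltnS leq_addr.
by apply: (addrI (f (x :: s))); rewrite -f2 addr0.
Qed.

Definition gen_norm : Qv := (1 - vv ^- 2)^-1.

Lemma form1_word s : s != [::] -> form 1 (word s) = 0.
Proof. by case: hform => fC _ _ _ s0; rewrite fC form_word1. Qed.

(** For a word x s' of length at least two, expand (E_j, E_x E_s'): each term of
    r(E_j) has a factor 1 on one side, and pairs it with a nonempty word. *)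
Lemma form_word_gen s j :
  form (word s) (E j) = if s == [:: j] then gen_norm else 0.
Proof.
case: hform => fC _ fE _.
have E1 z : E z = word [:: z] by rewrite word_cons word_nil mulr1.
case: s => [|x [|y s]].
- by rewrite word_nil E1 form1_word.
- by rewrite -E1 fE eqseq_cons andbT.
rewrite fC [in LHS]word_cons E1 form_word_mul big_seq.
rewrite [RHS](_ : _ = 0) ?big1 //; last by case: eqP.
move=> p /size_coprod /=; case: p.2.1 => [|z [|z' w]].
- by rewrite word_nil E1 form1_word // mul0r mulr0.
- rewrite addSn => -[/size0nil ->].
  by rewrite word_nil form1_word // !mulr0.
by rewrite !addSn.
Qed.

Lemma form_word_step j s t : form (word s) (word (j :: t)) =
  gen_norm * extract j (fun w => form (word w) (word t)) s.
Proof.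
case: s => [|x s]; first by rewrite mulr0 word_nil form1_word.
rewrite [word (j :: t)]word_cons form_word_mul -coprod_extract mulr_sumr.
rewrite [RHS]big_mkcond; apply: eq_bigr => p _.
rewrite form_word_gen; case: eqP => _; last by rewrite mul0r mulr0.
by rewrite mulrCA.
Qed.

Section Particles.
Variables (X : eqType) (tg : X -> I) (rho : X -> nat).

Local Notation before := (relpre rho ltn).

(** The sum of the pairings of tags over the pairs that u lists in the order
    opposite to rho. *)
Fixpoint inv_weight (u : seq X) : int :=
  if u is x :: u' then
    \sum_(y <- u' | (rho y < rho x)%N) c (tg y) (tg x) + inv_weight u'
  else 0.

Lemma before_trans : transitive before.
Proof. by move=> y x z; apply: ltn_trans. Qed.

(** When the letters carry distinct increasing ranks, an occurrence of j is a
    point x of tag j, and the letters preceding it are those of smaller rank. *)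
Lemma extract_map j G (s : seq X) : sorted before s ->
  extract j G (map tg s) =
  \sum_(x <- s | tg x == j)
    vv ^ (\sum_(y <- s | (rho y < rho x)%N) c (tg y) (tg x))
    * G (map tg (rem x s)).
Proof.
elim: s G => [|x s IH] G; first by rewrite big_nil.
rewrite /= path_sortedE; last exact: before_trans.
case/andP => /allP ltx srt.
rewrite big_mkcond big_cons /= eqxx; congr (_ + _).
  case: eqP => // _; rewrite big1_seq ?mul1r // => y /andP[lyx].
  rewrite inE => /predU1P[yx|/ltx lxy]; first by rewrite yx ltnn in lyx.
  by have := ltn_trans lyx lxy; rewrite ltnn.
rewrite IH // mulr_sumr [LHS]big_mkcond !big_seq.
apply: eq_bigr => y sy; case: eqP => // yj.
have lxy : (rho x < rho y)%N := ltx y sy.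
rewrite big_cons lxy yj expfzDr ?vv_neq0 // mulrA.
by case: eqP lxy => // ->; rewrite ltnn.
Qed.

(** The quantum shuffle formula.  A letter-preserving bijection from s to t is
    encoded as a rearrangement u of s whose tags spell t; peeling off the head
    x of u matches the recursion that strips the first letter of t. *)
Lemma form_word_permutations (s : seq X) t : sorted before s ->
  form (word (map tg s)) (word t) = gen_norm ^+ size t *
    \sum_(u <- permutations s | map tg u == t) vv ^ inv_weight u.
Proof.
elim: t s => [|j t IH] s srt.
  rewrite mul1r word_nil; case: s srt => [|x s] srt.
    case: hform => _ h11 _ _.
    by rewrite word_nil big_cons big_nil addr0.
  rewrite form_word1 // big1_seq // => u /andP[/eqP u0].
  by rewrite mem_permutations => /perm_size; case: u u0.
rewrite form_word_step extract_map // exprS -mulrA; congr (_ * _).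
have us : uniq s.
  by apply: sorted_uniq srt => [|x]; [exact: before_trans | exact: ltnn].
case: (altP (s =P [::])) => [->|s0].
  rewrite big_nil big1_seq ?mulr0 // => u /andP[/eqP u0].
  by rewrite mem_permutations => /perm_size; case: u u0.
rewrite (perm_big _ (permutationsE _)) /=; last by case: s s0 {srt us}.
rewrite [in RHS]big_mkcond big_allpairs_dep /= mulr_sumr undup_id //.
rewrite big_mkcond !big_seq; apply: eq_bigr => x sx.
have -> : \sum_(u <- permutations (rem x s))
    (if map tg (x :: u) == j :: t then vv ^ inv_weight (x :: u) else 0) =
  if tg x == j then
    vv ^ (\sum_(y <- s | (rho y < rho x)%N) c (tg y) (tg x)) *
    \sum_(u <- permutations (rem x s) | map tg u == t) vv ^ inv_weight u
  else 0.
  case: eqP => [xj|xj]; last first.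
    by rewrite big1 // => u _; rewrite eqseq_cons; case: eqP xj.
  rewrite mulr_sumr [RHS]big_mkcond !big_seq; apply: eq_bigr => u.
  rewrite mem_permutations => pu.
  rewrite eqseq_cons xj eqxx /=; case: eqP => // _.
  rewrite expfzDr ?vv_neq0 //; congr (vv ^ _ * _).
  rewrite (perm_big _ pu) [in RHS](perm_big _ (perm_to_rem sx)) /=.
  by rewrite big_cons ltnn xj.
case: eqP => _; last by rewrite mulr0.
rewrite IH; first by rewrite mulrCA.
exact: (subseq_sorted before_trans (rem_subseq x s)).
Qed.
End Particles.
End Form.
End Shuffle.

(** * Length and inversions in S_v *)

Section Length.
Local Open Scope nat_scope.

Section OnePerm.
Variable n : nat.
Implicit Types s : 'S_n.

Definition inversions s : {set 'I_n * 'I_n} :=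
  [set pq : 'I_n * 'I_n | (pq.1 < pq.2) && (s pq.2 < s pq.1)].

Lemma inversions1 : inversions 1 = set0.
Proof. by apply/setP => -[p q]; rewrite !inE !perm1 /=; lia. Qed.

(** Exchanging p and q in both members of a pair turns the inversions of
    tperm p q * s into those of s other than (p, q), because an adjacent
    transposition preserves the order of every other pair. *)
Lemma card_inversions_tperm s (p q : 'I_n) : q = p.+1 :> nat -> s q < s p ->
  #|inversions s| = #|inversions (tperm p q * s)|.+1.
Proof.
move=> qp spq.
pose t2 (xy : 'I_n * 'I_n) := (tperm p q xy.1, tperm p q xy.2).
have t2K : involutive t2 by case=> x y; rewrite /t2 /= !tpermK.
rewrite -(card_imset (inversions (tperm p q * s)) (inv_inj t2K)).
have -> : inversions s = (p, q) |: t2 @: inversions (tperm p q * s).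
  apply/setP => -[x y]; rewrite !inE xpair_eqE.
  have -> : ((x, y) \in t2 @: inversions (tperm p q * s)) =
            (t2 (x, y) \in inversions (tperm p q * s)).
    by rewrite -{1}(t2K (x, y)) mem_imset //; exact: inv_inj.
  rewrite inE /= !permM !tpermK.
  have neq (u w : 'I_n) : u <> w -> u <> w :> nat by move=> uw /val_inj.
  by case: (tpermP p q x) => [->|->|/neq nxp /neq nxq];
    case: (tpermP p q y) => [->|->|/neq nyp /neq nyq];
    rewrite ?eqxx -?val_eqE /=; lia.
rewrite cardsU1; case: imsetP => //= -[xy]; rewrite inE.
move=> /andP[xy1 _] [pE qE]; move: xy1 => /=.
have -> : xy.1 = q by rewrite -(tpermK p q xy.1) -pE tpermL.
have -> : xy.2 = p by rewrite -(tpermK p q xy.2) -qE tpermR.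
lia.
Qed.

(** Without descents s and its inverse are both increasing, so p <= s p and
    s p <= s^-1 (s p) = p. *)
Lemma no_descent_id s :
  (forall p q : 'I_n, q = p.+1 :> nat -> s p < s q) -> s = 1%g.
Proof.
move=> inc.
have mono (p q : 'I_n) : p < q -> s p < s q.
  move: q; case=> q; elim: q => // q IH qn /= pq.
  have qn' : q < n by lia.
  have := inc (Ordinal qn') (Ordinal qn) erefl => lq.
  move: pq; rewrite ltnS leq_eqVlt => /predU1P[pq|pq].
    by rewrite (_ : p = Ordinal qn') //; apply: val_inj.
  exact: ltn_trans (IH qn' pq) lq.
have monoV (p q : 'I_n) : p < q -> (s^-1)%g p < (s^-1)%g q.
  move=> pq; rewrite ltnNge leq_eqVlt negb_or.
  apply/andP; split; last first.
    by apply/negP => /mono; rewrite !permKV ltnNge ltnW.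
  apply/negP => /eqP/val_inj/perm_inj qp.
  by rewrite qp ltnn in pq.
have ge (f : 'I_n -> 'I_n) :
    (forall p q : 'I_n, p < q -> f p < f q) -> forall p : 'I_n, p <= f p.
  move=> mf [p]; elim: p => // p IH pn.
  have pn' : p < n by lia.
  by apply: leq_ltn_trans (IH pn') (mf (Ordinal pn') (Ordinal pn) (ltnSn _)).
apply/permP => p; rewrite perm1; apply/val_inj/eqP.
rewrite eqn_leq (ge _ mono) andbT.
by have := ge _ monoV (s p); rewrite permK.
Qed.

End OnePerm.

Section Weyl.
Variables (I : finType) (v : I -> nat).
Implicit Types w s : weyl v.

Definition ninv w : nat := \sum_i #|inversions (w i)|.

Lemma weyl1E i : (1 : weyl v)%g i = 1%g.
Proof. by rewrite ffunE. Qed.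

Lemma weylME w w' i : (w * w')%g i = (w i * w' i)%g.
Proof. by rewrite dffunM. Qed.

Lemma ninv1 : ninv 1%g = 0.
Proof. by rewrite /ninv big1 // => i _; rewrite weyl1E inversions1 cards0. Qed.

Lemma ninv_descent w i (p q : 'I_(v i)) : q = p.+1 :> nat -> w i q < w i p ->
  ninv w = (ninv (dfung1 (tperm p q) * w)%g).+1.
Proof.
move=> qp wpq; rewrite /ninv (bigD1 i) //= [in RHS](bigD1 i) //=.
rewrite weylME dfung1_id -addSn -(card_inversions_tperm qp wpq).
congr (_ + _); apply: eq_bigr => j nji.
by rewrite weylME dfung1_dflt 1?eq_sym // mul1g.
Qed.

Lemma dfung1_tpermK i (p q : 'I_(v i)) :
  (dfung1 (tperm p q) * dfung1 (tperm p q))%g = 1%g :> weyl v.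
Proof.
rewrite -dfung1_morphM tperm2; apply/ffunP => j; rewrite !ffunE.
by case: dfwithP.
Qed.

Lemma ninv_simple s w : simple_refl s -> ninv (s * w)%g <= (ninv w).+1.
Proof.
move=> /existsP[i /existsP[p /existsP[q /andP[/eqP qp /eqP ->]]]].
case: (ltngtP (w i q) (w i p)) => [lt|lt|/val_inj/perm_inj eq_qp].
- by rewrite (ninv_descent qp lt) !leqW.
- rewrite (@ninv_descent (dfung1 (tperm p q) * w)%g i p q) //.
    by rewrite mulgA dfung1_tpermK mul1g.
  by rewrite weylME dfung1_id !permM tpermL tpermR.
- by rewrite eq_qp in qp; lia.
Qed.

Lemma ninv_word (t : seq (weyl v)) :
  all (@simple_refl I v) t -> ninv (\prod_(s <- t) s)%g <= size t.
Proof.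
elim: t => [|s t IH] /=; first by rewrite big_nil ninv1.
case/andP => /ninv_simple st /IH lt; rewrite big_cons.
exact: leq_trans (st _) _.
Qed.

Lemma exists_descent w : w != 1%g -> exists s,
  simple_refl s /\ ninv w = (ninv (s * w)%g).+1.
Proof.
move=> w1.
have [i wi1] : exists i, w i != 1%g.
  apply/existsP; rewrite -negb_forall; apply: contra w1 => /forallP w1.
  by apply/eqP/ffunP => i; rewrite weyl1E; apply/eqP.
have [[p q] /andP[/eqP qp wqp]] :
    exists pq : 'I_(v i) * 'I_(v i), (pq.2 == pq.1.+1 :> nat) &&
      (w i pq.2 < w i pq.1).
  apply/existsP; apply: contraR wi1 => /existsPn nd; apply/eqP/no_descent_id.
  move=> p q qp; have := nd (p, q); rewrite /= qp eqxx /= -leqNgt leq_eqVlt.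
  case/predU1P => // /val_inj/perm_inj eq_qp; rewrite eq_qp in qp; lia.
exists (dfung1 (tperm p q)); split; last exact: ninv_descent.
apply/existsP; exists i; apply/existsP; exists p; apply/existsP; exists q.
by rewrite qp !eqxx.
Qed.

Lemma has_word_ninv w : has_word w (ninv w).
Proof.
have [n] := ubnP (ninv w); elim: n w => // n IH w lwn.
have [->|/exists_descent[s [ss ws]]] := eqVneq w 1%g.
  by rewrite ninv1; apply/existsP; exists [tuple]; rewrite big_nil eqxx.
have /existsP[t /andP[st /eqP wt]] : has_word (s * w)%g (ninv (s * w)%g).
  by apply: IH; lia.
rewrite ws; apply/existsP; exists [tuple of s :: t]; rewrite /= ss st big_cons.
rewrite wt mulgA.
case/existsP: ss => i /existsP[p /existsP[q /andP[_ /eqP ->]]].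
by rewrite dfung1_tpermK mul1g eqxx.
Qed.

(** Removing descents one at a time passes through every value below ninv w;
    so there are at least ninv w + 1 elements, and a reduced word is found
    within the search range #|weyl v|. *)
Lemma exists_ninv w k : k <= ninv w -> exists w', ninv w' = k.
Proof.
have [n] := ubnP (ninv w); elim: n w => // n IH w lwn.
rewrite leq_eqVlt => /predU1P[->|]; first by exists w.
have [->|/exists_descent[s [ss ws]]] := eqVneq w 1%g; first by rewrite ninv1.
by rewrite ws ltnS; apply: IH; lia.
Qed.

Lemma ninv_lt_card w : ninv w < #|weyl v|.
Proof.
have ex (k : 'I_(ninv w).+1) : exists w', ninv w' == k.
  have [w' <-] := @exists_ninv w k (ltn_ord k); by exists w'.
pose f k := xchoose (ex k).
have finj : injective f.
  move=> k l kl; apply: val_inj => /=.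
  by rewrite -(eqP (xchooseP (ex k))) -(eqP (xchooseP (ex l))) -/(f k) kl.
by rewrite -(card_ord (ninv w).+1) -(card_codom finj) max_card.
Qed.

Lemma weyl_length_ninv w : weyl_length w = ninv w.
Proof.
rewrite /weyl_length; set f := find _ _.
have hasw : has (has_word w) (iota 0 #|weyl v|).
  apply/hasP; exists (ninv w); last exact: has_word_ninv.
  by rewrite mem_iota add0n ninv_lt_card.
have lt : f < #|weyl v| by rewrite -[ltnRHS](size_iota 0) -has_find.
apply/eqP; rewrite eqn_leq; apply/andP; split.
  rewrite leqNgt; apply/negP => /(before_find 0).
  by rewrite nth_iota ?ninv_lt_card // has_word_ninv.
have := nth_find 0 hasw; rewrite -/f nth_iota //.
case/existsP => t /andP[st /eqP <-].
by rewrite -[leqRHS](size_tuple t) ninv_word.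
Qed.

End Weyl.
End Length.

(** * The order that a word puts on the particles *)

Section Labels.
Local Open Scope nat_scope.
Variable I : eqType.
Implicit Types (t : seq I) (i : I) (p : nat).

(** Each letter is labelled by the number of equal letters to its right.  Thus
    a suffix of t contains exactly the (i, p) with p below some bound, just as
    B-stable subspaces are spanned by the first few basis vectors. *)
Fixpoint labels t : seq (I * nat) :=
  if t is i :: t' then (i, count_mem i t') :: labels t' else [::].

Lemma labels_fst t : map fst (labels t) = t.
Proof. by elim: t => //= i t ->. Qed.

Lemma mem_labels t i p : ((i, p) \in labels t) = (p < count_mem i t).
Proof.
elim: t => //= j t IH; rewrite inE xpair_eqE IH [i == j]eq_sym.
by case: eqP => [->|_] //=; lia.
Qed.

Lemma labels_uniq t : uniq (labels t).
Proof. by elim: t => //= i t ->; rewrite mem_labels ltnn. Qed.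

Lemma leq_index_labels t i p n : p < count_mem i t ->
  (n <= index (i, p) (labels t)) = (p < count_mem i (drop n t)).
Proof.
elim: t n => //= j t IH [|n] /=; first by move=> ->.
move=> lp; rewrite xpair_eqE.
have cd : count_mem i (drop n t) <= count_mem i t.
  by rewrite -[X in _ <= count_mem i X](cat_take_drop n t) count_cat leq_addl.
have [ji|nji] := eqVneq j i; last first.
  by rewrite /= ltnS IH //; move: lp; rewrite (negPf nji).
have [cp|ncp] := eqVneq (count_mem j t) p; rewrite /= ?ltnS.
  by rewrite -cp ji ltn0 ltnNge cd.
by rewrite IH //; move: lp ncp; rewrite ji eqxx; lia.
Qed.

End Labels.

Section ParticleOrder.
Variables (I : finType) (v : I -> nat).

(** (i, p) stands for the p-th basis vector of K^(v i). *)
Definition particle := {i : I & 'I_(v i)}.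
Implicit Types (x y : particle) (t : seq I).

Definition code x : I * nat := (tag x, val (tagged x)).

Lemma code_inj : injective code.
Proof.
move=> [i p] [j q] [/= ij]; case: _ / ij q => q /= pq.
by congr (Tagged _ _); apply: val_inj.
Qed.

Definition uncode (ip : I * nat) : option particle :=
  omap (fun p : 'I_(v ip.1) => Tagged (fun i => 'I_(v i)) p) (insub ip.2).

Definition particles t : seq particle := pmap uncode (labels t).

Definition rank t x : nat := index (code x) (labels t).

Section Word.
Variable t : seq I.
Hypothesis ht : forall i, count_mem i t = v i.

Lemma code_particles : map code (particles t) = labels t.
Proof.
rewrite /particles (@pmap_filter _ _ uncode code); last first.
  case=> i p; rewrite /uncode /=; case: insubP => //= u _ up.
  by rewrite /code /= up.
apply/all_filterP/allP => -[i p]; rewrite mem_labels ht => pv.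
by rewrite /uncode /= insubT.
Qed.

Lemma tag_particles : map tag (particles t) = t.
Proof.
by rewrite -[RHS]labels_fst -code_particles -map_comp; apply: eq_map.
Qed.

Lemma particles_uniq : uniq (particles t).
Proof. by rewrite -(map_inj_uniq code_inj) code_particles labels_uniq. Qed.

Lemma mem_particles x : x \in particles t.
Proof.
by rewrite -(mem_map code_inj) code_particles mem_labels ht ltn_ord.
Qed.

Lemma rankE x : rank t x = index x (particles t).
Proof. by rewrite /rank -code_particles index_map //; apply: code_inj. Qed.

Lemma rank_inj : injective (rank t).
Proof.
move=> x y; rewrite !rankE => xy.
by rewrite -(nth_index x (mem_particles x)) xy nth_index ?mem_particles.
Qed.

Lemma particles_sorted : sorted (relpre (rank t) ltn) (particles t).
Proof.
case E : (particles t) => [|x0 s] //; rewrite -E.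
apply/(sortedP x0) => i lti; rewrite /= !rankE !index_uniq ?particles_uniq //.
exact: ltnW.
Qed.

Lemma leq_rank n x :
  (n <= rank t x)%N = (tagged x < count_mem (tag x) (drop n t))%N.
Proof. by rewrite leq_index_labels // ht ltn_ord. Qed.

(** The labels of a letter decrease along the word; as this holds for every
    word, reversing the order of equal letters in all words does not change
    which pairs of them are inverted. *)
Lemma ltn_rank_same i (p q : 'I_(v i)) :
  (rank t (Tagged _ p) < rank t (Tagged _ q))%N = (q < p)%N.
Proof.
have le (p1 q1 : 'I_(v i)) : (q1 <= p1)%N ->
    (rank t (Tagged _ p1) <= rank t (Tagged _ q1))%N.
  move=> qp; rewrite leq_rank; apply: leq_ltn_trans qp _.
  by rewrite -(leq_rank _ (Tagged _ p1)).
apply/idP/idP => [|qp]; last first.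
  rewrite ltn_neqAle le 1?ltnW // andbT; apply: contraL qp => /eqP/rank_inj.
  by move/eqP; rewrite eq_Tagged /= => /eqP ->; rewrite ltnn.
by apply: contraLR; rewrite -!leqNgt; apply: le.
Qed.

Lemma ltn_rank_total x y : x != y ->
  (rank t y < rank t x)%N = ~~ (rank t x < rank t y)%N.
Proof.
move=> nxy; rewrite -leqNgt [RHS]leq_eqVlt (inj_eq rank_inj) eq_sym.
by rewrite (negPf nxy).
Qed.

Lemma sum_particles (V : nmodType) (F : particle -> V) :
  \sum_(x <- particles t) F x = \sum_x F x.
Proof.
apply: perm_big; apply: uniq_perm; rewrite ?particles_uniq ?index_enum_uniq //.
by move=> x; rewrite mem_particles mem_index_enum.
Qed.

End Word.

Definition weyl_act (w : weyl v) x : particle :=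
  Tagged (fun i => 'I_(v i)) (w (tag x) (tagged x)).

Lemma weyl_act_inj w : injective (weyl_act w).
Proof.
move=> [i p] [j q] /= e; have ij : i = j := congr1 tag e.
case: _ / ij q e => q /eqP; rewrite eq_Tagged /= => /eqP/perm_inj -> //.
Qed.

Lemma particle_map_act (f : particle -> particle) :
  injective f -> (forall x, tag (f x) = tag x) ->
  exists w, f =1 weyl_act w.
Proof.
move=> finj ft.
pose g i (p : 'I_(v i)) : 'I_(v i) :=
  tagged_as (Tagged (fun i => 'I_(v i)) p) (f (Tagged _ p)).
have gE i p : Tagged (fun i => 'I_(v i)) (g i p) = f (Tagged _ p).
  rewrite /g; have := ft (Tagged _ p); case: (f _) => j q /= ji.
  by case: _ / ji p => p; rewrite tagged_asE.
have ginj i : injective (g i).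
  move=> p q pq; have /eqP : f (Tagged _ p) = f (Tagged _ q) by rewrite -!gE pq.
  by rewrite (inj_eq finj) eq_Tagged /= => /eqP.
exists [ffun i => perm (@ginj i)] => -[i p].
by rewrite /weyl_act /= ffunE permE gE.
Qed.

(** A rearrangement u of the particles that spells t' is the image of the list
    for t' under a unique element of S_v: the bijection sending the k-th
    particle of that list to the k-th one of u preserves tags. *)
Lemma sum_permutations_act (V : nmodType) (t t' : seq I)
    (ht : forall i, count_mem i t = v i) (ht' : forall i, count_mem i t' = v i)
    (F : seq particle -> V) :
  \sum_(u <- permutations (particles t) | map tag u == t') F u =
  \sum_w F (map (weyl_act w) (particles t')).
Proof.
rewrite -big_filter.
rewrite -(big_map (fun w => map (weyl_act w) (particles t')) predT F).
apply: perm_big; apply: uniq_perm.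
- by rewrite filter_uniq // permutations_uniq.
- rewrite map_inj_uniq ?index_enum_uniq // => w w' /eq_in_map eqw.
  apply/ffunP => i; apply/permP => p.
  have /eqP := eqw (Tagged (fun i => 'I_(v i)) p) (mem_particles ht' _).
  by rewrite eq_Tagged => /eqP.
move=> u; rewrite mem_filter mem_permutations; apply/andP/mapP.
- case=> /eqP tu pu.
  have uu : uniq u by rewrite (perm_uniq pu) particles_uniq.
  have su : size u = size (particles t').
    by rewrite -(size_map tag u) tu -{1}(tag_particles ht') size_map.
  pose f x := nth x u (index x (particles t')).
  have lt x : (index x (particles t') < size u)%N.
    by rewrite su index_mem mem_particles.
  have finj : injective f.
    move=> x y /eqP; rewrite /f (set_nth_default x y) // nth_uniq // => /eqP xy.
    by rewrite -(nth_index x (mem_particles ht' x)) xy nth_index ?mem_particles.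
  have [|w fw] := particle_map_act finj.
    move=> x; rewrite -(nth_map _ (tag x)) // tu -{1}(tag_particles ht').
    by rewrite (nth_map x) -?su // nth_index ?mem_particles.
  exists w; first by rewrite mem_index_enum.
  rewrite -(eq_map fw); case E : u => [|x0 u0].
    by have /eqP := su; rewrite E eq_sym size_eq0 => /eqP ->.
  rewrite -E; apply: (@eq_from_nth _ x0); first by rewrite size_map.
  move=> k ku; rewrite (nth_map x0) -?su // /f.
  by rewrite index_uniq ?particles_uniq -?su //; apply: set_nth_default.
case=> w _ ->; split.
  by rewrite -map_comp -{2}(tag_particles ht'); apply/eqP/eq_map.
apply: uniq_perm; rewrite ?particles_uniq //.
  by rewrite map_inj_uniq ?particles_uniq //; apply: weyl_act_inj.
move=> x; rewrite mem_particles //; apply/mapP.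
have [w' w'K] : exists w', cancel w' (weyl_act w).
  by exists (invF (@weyl_act_inj w)) => y; apply: f_invF.
by exists (w' x); rewrite ?mem_particles ?w'K.
Qed.

Lemma inv_weight_map (X : eqType) (c : I -> I -> int) (tg : X -> I)
    (rho sigma : X -> nat) (f : X -> X) s :
  sorted (relpre sigma ltn) s ->
  inv_weight c tg rho (map f s) =
  \sum_(x <- s)
    \sum_(y <- s | (rho (f y) < rho (f x))%N && (sigma x < sigma y)%N)
      c (tg (f y)) (tg (f x)).
Proof.
elim: s => [|x s IH]; first by rewrite big_nil.
rewrite /= path_sortedE; last by move=> ? ? ?; apply: ltn_trans.
case/andP => /allP ltx srt; rewrite IH // big_cons big_map; congr (_ + _).
  rewrite big_cons !ltnn /= [LHS]big_seq_cond [RHS]big_seq_cond.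
  apply: eq_bigl => y; case ys: (y \in s) => //=.
  by have /= -> := ltx y ys; rewrite andbT.
rewrite !big_seq; apply: eq_bigr => y /ltx /= lxy.
by rewrite big_cons [(sigma y < _)%N]ltnNge (ltnW lxy) andbF.
Qed.

End ParticleOrder.

(** * The exponents agree term by term *)

Lemma card_pairs (T : finType) (P : rel T) :
  #|[set xy : T * T | P xy.1 xy.2]|%:Z = \sum_x \sum_y (P x y)%:Z.
Proof.
rewrite -sum1_card -natz natr_sum pair_big big_mkcond /=.
by apply: eq_bigr => xy _; rewrite inE; case: (P _ _).
Qed.

Section Exponent.
Variables (I : finType) (c : I -> I -> int) (arr : rel I) (v : I -> nat).
Hypothesis cE : forall i j,
  c i j = (2 * (i == j))%:Z - (arr i j)%:Z - (arr j i)%:Z.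
Hypothesis arr_irr : forall i j, arr i j -> i != j.
Variables (t t' : seq I).
Hypothesis ht : forall i, count_mem i t = v i.
Hypothesis ht' : forall i, count_mem i t' = v i.
Implicit Types (x y : particle v) (w : weyl v).

Definition edges s : {set particle v * particle v} :=
  [set xy : particle v * particle v |
    arr (tag xy.1) (tag xy.2) && (rank s xy.1 < rank s xy.2)%N].

Definition common_edges w : {set particle v * particle v} :=
  [set xy : particle v * particle v |
   [&& arr (tag xy.1) (tag xy.2),
     (rank t (weyl_act w xy.1) < rank t (weyl_act w xy.2))%N &
     (rank t' xy.1 < rank t' xy.2)%N]].

Lemma sum_same_tag (V : nmodType) (G : particle v -> particle v -> V) :
  \sum_x \sum_(y | tag y == tag x) G x y =
  \sum_i \sum_(p < v i) \sum_(q < v i)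
     G (Tagged (fun i => 'I_(v i)) p) (Tagged (fun i => 'I_(v i)) q).
Proof.
pose pt i (p : 'I_(v i)) := Tagged (fun i => 'I_(v i)) p.
rewrite [RHS](@sig_big_dep V 0 +%R I (fun i => 'I_(v i)) predT
  (fun _ => predT) (fun i p => \sum_(q < v i) G (pt i p) (pt i q))) /=.
apply: eq_bigr => -[i p] _ /=.
have := @sig_big_dep V 0 +%R I (fun i => 'I_(v i)) (pred1 i)
  (fun _ => predT) (fun j (q : 'I_(v j)) => G (pt i p) (pt j q)).
rewrite big_pred1_eq => ->.
by apply: eq_big => [[j q]|[j q] _] //=; rewrite andbT.
Qed.

Lemma edges_act w : #|edges t|%:Z = \sum_x \sum_y
  (arr (tag x) (tag y) && (rank t (weyl_act w x) < rank t (weyl_act w y))%N)%:Z.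
Proof.
rewrite (card_pairs
  (fun x y => arr (tag x) (tag y) && (rank t x < rank t y)%N)).
rewrite (reindex_inj (@weyl_act_inj _ _ w)); apply: eq_bigr => x _.
by rewrite (reindex_inj (@weyl_act_inj _ _ w)).
Qed.

(** Let A be the order of t pulled back by w, and B the order of t'.  Only
    pairs of particles with equal tags or joined by an arrow matter.  In the
    first case the inverted pairs are the inversions of w, each of weight 2.  In
    the second, each pair on which A and B disagree has weight -1, and the
    number of disagreements is |A| + |B| - 2 |A and B|. *)
Lemma inv_weight_act w :
  inv_weight c tag (rank t) (map (weyl_act w) (particles v t')) =
  2 * (ninv w + #|common_edges w|)%:Z - #|edges t|%:Z - #|edges t'|%:Z.
Proof.
rewrite (inv_weight_map _ _ _ _ (particles_sorted ht')) sum_particles //.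
pose A x y := (rank t (weyl_act w x) < rank t (weyl_act w y))%N.
pose B x y := (rank t' x < rank t' y)%N.
rewrite (edges_act w).
rewrite (card_pairs (fun x y => arr (tag x) (tag y) && B x y)).
rewrite PoszD.
rewrite (card_pairs (fun x y => [&& arr (tag x) (tag y), A x y & B x y])).
have -> : (ninv w)%:Z = \sum_x \sum_(y | tag y == tag x) (A y x && B x y)%:Z.
  rewrite sum_same_tag /ninv -natz natr_sum; apply: eq_bigr => i _.
  rewrite natz (card_pairs
    (fun p q : 'I_(v i) => (p < q)%N && (w i q < w i p)%N)).
  rewrite exchange_big; apply: eq_bigr => p _; apply: eq_bigr => q _.
  by rewrite /A /B !ltn_rank_same // andbC.
(* Each arrow joins the pair x, y in one of the two directions; exchanging the
   summation variables in one half makes all arrows go from x to y. *)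
transitivity (\sum_x \sum_y ((A y x && B x y)%:Z * (2 * (tag y == tag x))%:Z
   - (arr (tag x) (tag y) && (A x y != B x y))%:Z)).
  transitivity (\sum_x \sum_y ((A y x && B x y)%:Z * (2 * (tag y == tag x))%:Z
     - (A y x && B x y)%:Z * (arr (tag x) (tag y))%:Z)
    - \sum_x \sum_y ((A x y && B y x)%:Z * (arr (tag x) (tag y))%:Z)).
    rewrite [X in _ = _ - X]exchange_big -sumrB; apply: eq_bigr => x _.
    rewrite -sumrB big_mkcond sum_particles //; apply: eq_bigr => y _ /=.
    rewrite -/(A y x) -/(B x y) cE; case: (A y x && B x y) => /=; lia.
  rewrite -sumrB; apply: eq_bigr => x _; rewrite -sumrB; apply: eq_bigr => y _.
  case a : (arr (tag x) (tag y)) => /=; last lia.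
  have nxy : x != y by apply: contraTneq (arr_irr a) => ->; rewrite eqxx.
  have -> : A y x = ~~ A x y.
    by rewrite /A (ltn_rank_total ht) // (inj_eq (@weyl_act_inj _ _ w)).
  have -> : B y x = ~~ B x y by rewrite /B (ltn_rank_total ht').
  by case: (A x y); case: (B x y); lia.
rewrite mulrDr !mulr_sumr -[RHS]addrA -opprD -!big_split -sumrB /=.
apply: eq_bigr => x _.
rewrite [in RHS]big_mkcond !mulr_sumr -!big_split -sumrB /=.
apply: eq_bigr => y _.
rewrite -/(A x y); case: (arr _ _); case: (A x y);
  by case: (A y x); case: (B x y); case: (tag y == _).
Qed.

End Exponent.

(** * Coordinate subspaces and B-stable subspaces *)

Section CoordinateSubspace.
Variables (K : fieldType) (V : vectType K) (J : finType).
Variables (e : J -> V) (f : J -> V -> K).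
Hypothesis f_lin : forall k, scalar (f k).
Hypothesis f_inj : forall u, (forall k, f k u = 0) -> u = 0.
Hypothesis fe : forall k l, f k (e l) = (k == l)%:R.

Lemma coord0 k : f k 0 = 0.
Proof. by have := f_lin k (-1) 0 0; rewrite scaler0 add0r mulN1r addNr. Qed.

Lemma coord_sum (T : finType) (r : T -> K) (g : T -> J) k :
  f k (\sum_i r i *: e (g i)) = \sum_i r i * (k == g i)%:R.
Proof.
have fD : {morph f k : x y / x + y}.
  by move=> x y; have := f_lin k 1 x y; rewrite scale1r mul1r.
have fZ a x : f k (a *: x) = a * f k x.
  by have := f_lin k a x 0; rewrite addr0 coord0 addr0.
by rewrite (big_morph _ fD (coord0 k)); apply: eq_bigr => i _; rewrite fZ fe.
Qed.

(** The e k with k in A form a basis of W, as each u is the sum of the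
    f k u *: e k. *)
Lemma dim_coord_subspace (W : {vspace V}) (A : {set J}) :
  (forall u, u \in W <-> forall k, k \notin A -> f k u = 0) ->
  \dim W = #|A|.
Proof.
move=> WE; pose b := [tuple e (enum_val i) | i < #|A|].
have bE (i : 'I_#|A|) : b`_i = e (enum_val i).
  by rewrite -[LHS](@tnth_nth _ _ 0 b) tnth_mktuple.
have fb : free b.
  apply/freeP => r sr j; have := congr1 (f (enum_val j)) sr.
  rewrite (eq_bigr (fun i => r i *: e (enum_val i))) => [|i]; last first.
    by rewrite bE.
  rewrite coord_sum (bigD1 j) //= eqxx mulr1 big1 ?addr0; last first.
    by move=> i nij; rewrite (inj_eq enum_val_inj) eq_sym (negPf nij) mulr0.
  by move=> ->; apply: coord0.
suff -> : W = <<b>>%VS by move/eqP: fb => ->; rewrite size_tuple.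
apply/eqP; rewrite eqEsubv; apply/andP; split; apply/subvP => u.
  move/WE => uA.
  have -> : u = \sum_(i < #|A|) f (enum_val i) u *: e (enum_val i).
    apply/eqP; rewrite -subr_eq0; apply/eqP; apply: f_inj => k.
    rewrite addrC -scaleN1r f_lin coord_sum mulN1r.
    have [kA|kA] := boolP (k \in A); last first.
      rewrite uA // addr0 big1 ?oppr0 // => i _; case: eqP => [ki|].
        by rewrite ki enum_valP in kA.
      by rewrite mulr0.
    rewrite (bigD1 (enum_rank_in kA k)) //= enum_rankK_in // eqxx mulr1 big1.
      by rewrite addr0 addNr.
    move=> i nik; case: eqP => [ki|]; last by rewrite mulr0.
    by rewrite -(enum_valK_in kA i) -ki eqxx in nik.
  apply: memv_suml => i _; rewrite -bE; apply/memvZ/memv_span/mem_nth.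
  by rewrite size_tuple.
suff /subvP : (<<b>> <= W)%VS by apply.
apply/span_subvP => _ /mapP[i _ ->]; apply/WE => l.
rewrite fe; case: eqP => // ->; by rewrite enum_valP.
Qed.

End CoordinateSubspace.

Lemma mem_initial_segment n (S : {set 'I_n}) :
  (forall p q : 'I_n, p \in S -> (q <= p)%N -> q \in S) ->
  forall p : 'I_n, (p \in S) = (p < #|S|)%N.
Proof.
move=> Sdown p.
have cseg (k : nat) : (k <= n)%N -> #|[set q : 'I_n | (q < k)%N]| = k.
  move=> kn; rewrite -sum1_card (eq_bigl (fun q : 'I_n => (q < k)%N)).
    by rewrite (big_ord_narrow kn) /= sum_nat_const card_ord muln1.
  by move=> q; rewrite inE.
apply/idP/idP => [pS|].
  rewrite -(cseg p.+1) // subset_leq_card //.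
  by apply/subsetP => q; rewrite inE ltnS; apply: Sdown.
apply: contraLR => pS; rewrite -leqNgt -[leqRHS](cseg p (ltnW (ltn_ord p))).
rewrite subset_leq_card //; apply/subsetP => q qS; rewrite inE ltnNge.
by apply: contra pS; apply: Sdown.
Qed.

Section Geometry.
Variables (K : fieldType) (I : finType) (v : I -> nat).
Hypothesis K2 : (2 : K) != 0.
Variable b : GLfam K v.
Hypothesis hb : inGL b.

Definition vcoord i (p : 'I_(v i)) (u : 'cV[K]_(v i)) : K :=
  (invmx (b i) *m u) p 0.

Lemma vcoord_scalar i p : scalar (@vcoord i p).
Proof.
by move=> a u w; rewrite /vcoord mulmxDr -scalemxAr !mxE.
Qed.

Lemma vcoord_inj i u : (forall p, @vcoord i p u = 0) -> u = 0.
Proof.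
move=> u0; rewrite -[u](mulKVmx (hb i)) (_ : _ *m u = 0) ?mulmx0 //.
by apply/colP => p; rewrite [LHS]u0 mxE.
Qed.

Lemma vcoord_col i p q : @vcoord i p (col q (b i)) = (p == q)%:R.
Proof. by rewrite /vcoord colE mulmxA mulVmx // mul1mx mxE eqxx andbT. Qed.

(** In the basis b, this is 1 + E_qp in the factor i and 1 elsewhere.  Comparing
    tagged indices avoids a cast between the factors i and j. *)
Definition elem_gl i (q p : 'I_(v i)) : GLfam K v := fun j =>
  b j *m
  (1%:M + \matrix_(x, y)
     ((Tagged (fun i => 'I_(v i)) x == Tagged (fun i => 'I_(v i)) q) &&
      (Tagged (fun i => 'I_(v i)) y == Tagged (fun i => 'I_(v i)) p))%:R)
  *m invmx (b j).

(** For q = p the diagonal entry is 2, whence the hypothesis on K. *)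
Lemma elem_gl_borel i (q p : 'I_(v i)) : (q <= p)%N -> borel b (elem_gl q p).
Proof.
move=> qp.
have Nle j (x y : 'I_(v j)) : Tagged (fun i => 'I_(v i)) x == Tagged _ q ->
    Tagged (fun i => 'I_(v i)) y == Tagged _ p -> (x <= y)%N.
  by move=> /eqP/(congr1 (@code _ v))[_ ->] /eqP/(congr1 (@code _ v))[_ ->].
split=> [j|j x y yx]; last first.
  rewrite /in_basis /elem_gl !mulmxA mulVmx // mul1mx -mulmxA mulVmx //.
  rewrite mulmx1 !mxE; case: eqP => [xy|_]; first by rewrite xy ltnn in yx.
  case: andP => [[xq yp]|_]; last by rewrite addr0.
  by move: yx; rewrite ltnNge (Nle j x y).
rewrite /elem_gl !unitmx_mul hb unitmx_inv hb andbT /= unitmxE -det_tr.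
rewrite det_trig; last first.
  apply/is_trig_mxP => y x yx; rewrite !mxE.
  case: eqP => [xy|_]; first by rewrite xy ltnn in yx.
  case: andP => [[xq yp]|_]; last by rewrite addr0.
  by move: yx; rewrite ltnNge (Nle j x y).
rewrite unitfE prodf_seq_neq0; apply/allP => x _ /=; rewrite !mxE eqxx.
by case: andP => _; rewrite ?addr0 ?oner_neq0.
Qed.

Lemma elem_gl_mul i (q p : 'I_(v i)) u :
  elem_gl q p i *m u = u + vcoord p u *: col q (b i).
Proof.
rewrite /elem_gl -mulmxA -mulmxA mulmxDl mul1mx mulmxDr mulKVmx //.
congr (_ + _); rewrite colE scalemxAr; congr (_ *m _); apply/colP => x.
rewrite !mxE (bigD1 p) //= big1 ?addr0 => [|y nyp].
  by rewrite mxE !eq_Tagged /= !eqxx !andbT mulrC.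
by rewrite mxE !eq_Tagged /= (negPf nyp) andbF mul0r.
Qed.

Section BStable.
Variable W : gsub K v.
Hypothesis WB : bstable b W.

(** The element 1 + E_qp sends u to u + u_p b_q, so b_q lies in W as soon as u
    does and u_p is nonzero. *)
Lemma bstable_col i u (p q : 'I_(v i)) :
  u \in W i -> vcoord p u != 0 -> (q <= p)%N -> col q (b i) \in W i.
Proof.
move=> uW up qp; have := WB (elem_gl_borel qp) uW.
rewrite elem_gl_mul => /memvB/(_ uW); rewrite addrAC subrr add0r.
by move/(memvZ (vcoord p u)^-1); rewrite scalerA mulVf // scale1r.
Qed.

Lemma bstableP i u : u \in W i <->
  forall p, col p (b i) \notin W i -> vcoord p u = 0.
Proof.
split=> [uW p|H].
  by apply: contraNeq => up; apply: bstable_col uW up _.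
have -> : u = \sum_p vcoord p u *: col p (b i).
  rewrite -[LHS](mulKVmx (hb i)); apply/colP => x.
  rewrite mxE summxE; apply: eq_bigr => p _.
  by rewrite [RHS]mxE [X in _ = _ * X]mxE mulrC.
apply: memv_suml => p _; have [pW|/H ->] := boolP (col p (b i) \in W i).
  exact: memvZ.
by rewrite scale0r mem0v.
Qed.

(** A B-stable subspace is spanned by an initial segment of the basis, hence is
    determined by its dimension. *)
Lemma bstable_mem i (p : 'I_(v i)) : (col p (b i) \in W i) = (p < \dim (W i))%N.
Proof.
pose S := [set p | col p (b i) \in W i].
have -> : \dim (W i) = #|S|.
  apply: (dim_coord_subspace (@vcoord_scalar i) (@vcoord_inj i)
    (@vcoord_col i)).
  move=> u; rewrite bstableP; split=> H k; move: (H k); rewrite inE; exact.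
rewrite -mem_initial_segment; first by rewrite inE.
move=> p' q; rewrite !inE => pW qp; apply: bstable_col pW _ qp.
by rewrite vcoord_col eqxx oner_neq0.
Qed.

End BStable.
End Geometry.

(** * Flags of a given type, and coordinates on representations *)

Definition block_word (I : eqType) m (ii : 'I_m -> I) (a : 'I_m -> nat) :
    seq I :=
  flatten [seq nseq (a k) (ii k) | k <- enum 'I_m].

Lemma count_block_word (I : eqType) m (ii : 'I_m -> I) (a : 'I_m -> nat) i :
  count_mem i (block_word ii a) = (\sum_(k < m | ii k == i) a k)%N.
Proof.
rewrite /block_word count_flatten -map_comp sumnE big_map big_enum /=.
rewrite [RHS]big_mkcond; apply: eq_bigr => k _ /=.
by rewrite count_nseq /=; case: eqP; rewrite ?mul1n ?mul0n.
Qed.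

Section Flag.
Variables (K : fieldType) (I : finType) (v : I -> nat).
Hypothesis K2 : (2 : K) != 0.
Variable b : GLfam K v.
Hypothesis hb : inGL b.
Variables (m : nat) (ii : 'I_m -> I) (a : 'I_m -> nat) (F : nat -> gsub K v).
Hypothesis hw : has_weight ii a v.
Hypothesis hF : is_flag b ii a F.

Local Notation t := (block_word ii a).

Definition bvec (x : particle v) : 'cV[K]_(v (tag x)) :=
  col (tagged x) (b (tag x)).

(** F k has the dimension vector of the part of the word from block k on. *)
Lemma flag_suffix k : (k <= m)%N ->
  exists n, forall i, \dim (F k i) = count_mem i (drop n t).
Proof.
case: hF => _ Fm _ Fdim _ km.
pose s := [seq nseq (a l) (ii l) | l <- enum 'I_m].
exists (size (flatten (take k s))) => i.
have -> : t = flatten (take k s) ++ flatten (drop k s).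
  by rewrite -flatten_cat cat_take_drop.
rewrite drop_size_cat // /s {s} -map_drop.
have [n nE] : exists n, (k + n = m)%N by exists (m - k)%N; rewrite subnKC.
elim: n k km nE => [|n IH] k km nE.
  rewrite addn0 in nE; rewrite drop_oversize ?size_enum_ord ?nE //=.
  by rewrite Fm dimv0.
have ltk : (k < m)%N by rewrite -nE addnS ltnS leq_addr.
rewrite (drop_nth (Ordinal ltk)) ?size_enum_ord //.
rewrite -[X in nth _ _ X]/(nat_of_ord (Ordinal ltk)) nth_ord_enum /= count_cat.
rewrite -IH ?addSnnS // addnC count_nseq /= (Fdim (Ordinal ltk)) eq_sym.
by case: eqP; rewrite ?mul1n ?mul0n.
Qed.

Lemma flag_mem k : (k <= m)%N ->
  exists n, forall x, (bvec x \in F k (tag x)) = (n <= rank t x)%N.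
Proof.
move=> km; have [n nE] := flag_suffix km; exists n => x.
rewrite leq_rank; last by move=> i; rewrite count_block_word -hw.
case: hF => _ _ _ _ /(_ k km) Fk.
by rewrite /bvec (bstable_mem K2 hb Fk) nE.
Qed.

(** Passing to the full refinement of the flag does not change R_{i,a}.  If y
    came before x, consider the last term F k that contains x.  It contains y by
    hypothesis; but F k / F (k+1) is concentrated in the degree of x, so F (k+1)
    still contains y, although it does not contain the later x. *)
Lemma flag_allowed x y : tag x != tag y ->
  (forall k, (k <= m)%N -> bvec x \in F k (tag x) -> bvec y \in F k (tag y))
  <-> (rank t x < rank t y)%N.
Proof.
case: hF => F0 Fm _ Fdim Fb nxy.
have ht i : count_mem i t = v i by rewrite count_block_word -hw.
split=> [H|lxy k /flag_mem[n nE]]; last first.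
  by rewrite !nE => nx; apply: leq_trans nx (ltnW lxy).
rewrite ltnNge leq_eqVlt negb_or; apply/andP; split.
  by apply: contra nxy => /eqP/(rank_inj ht) ->.
apply/negP => lyx.
have x0 : bvec x \in F 0%N (tag x) by rewrite F0 memvf.
have xm : bvec x \notin F m (tag x).
  rewrite Fm memv0; apply/negP => /eqP bx0.
  have := vcoord_col hb (tagged x) (tagged x); rewrite -/(bvec x) bx0 eqxx.
  by rewrite /vcoord mulmx0 mxE => /eqP; rewrite eq_sym oner_eq0.
have [k km [xk nxk]] : exists2 k, (k < m)%N &
    bvec x \in F k (tag x) /\ bvec x \notin F k.+1 (tag x).
  have exk : exists k, bvec x \notin F k (tag x) by exists m.
  case: (ex_minnP exk) => -[|k] xk kmin; first by rewrite x0 in xk.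
  exists k; first exact: kmin xm.
  by split=> //; apply/negPn/negP => /kmin; rewrite ltnn.
have yk := H k (ltnW km) xk.
have [n nE] := flag_mem (km : (k.+1 <= m)%N).
have bmem j z : (j <= m)%N -> (bvec z \in F j (tag z)) =
    (tagged z < \dim (F j (tag z)))%N.
  by move=> jm; rewrite /bvec (bstable_mem K2 hb (Fb j jm)).
have xi : tag x = ii (Ordinal km).
  move: xk nxk; rewrite !bmem ?(ltnW km) // (Fdim (Ordinal km)) /=.
  by case: eqP => // _; rewrite addn0 => ->.
have : bvec y \in F k.+1 (tag y).
  move: yk; rewrite !bmem ?(ltnW km) // (Fdim (Ordinal km)) /=.
  by rewrite -xi eq_sym (negPf nxy) addn0.
move: nxk; rewrite !nE -ltnNge => xn yn.
by have := leq_ltn_trans (leq_trans yn (ltnW lyx)) xn; rewrite ltnn.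
Qed.

End Flag.

Section RepDim.
Variables (K : fieldType) (I : finType) (arr : rel I) (v : I -> nat).
Variable b : GLfam K v.
Hypothesis hb : inGL b.
Implicit Types (x y : rep K arr v) (k : rep_index arr v).

Definition rcoord k x : K :=
  let: existT h qp := k in
  (invmx (b (tgt h)) *m x h *m b (src h)) qp.1 qp.2.

Definition rbasis k : rep K arr v := [ffun h =>
  b (tgt h) *m (\matrix_(q, p) (existT _ h (q, p) == k)%:R)
  *m invmx (b (src h))].

Lemma rcoord_scalar k : scalar (rcoord k).
Proof.
case: k => h [q p] a x y; rewrite /rcoord repDE repZE mulmxDr mulmxDl.
by rewrite -scalemxAr -scalemxAl !mxE.
Qed.

Lemma rcoord_inj x : (forall k, rcoord k x = 0) -> x = 0.
Proof.
move=> x0; apply/ffunP => h; rewrite [RHS]ffunE.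
have xh : invmx (b (tgt h)) *m x h *m b (src h) = 0.
  by apply/matrixP => q p; rewrite [LHS](x0 (existT _ h (q, p))) mxE.
rewrite -[LHS](mulKVmx (hb _)) -[X in _ *m X](mulmxK (hb (src h))) xh.
by rewrite mul0mx mulmx0.
Qed.

Lemma rcoord_basis k l : rcoord k (rbasis l) = (k == l)%:R.
Proof.
case: k => h [q p]; rewrite /rcoord ffunE -!mulmxA mulVmx // mulmx1.
by rewrite mulKmx // mxE.
Qed.

(** The source and target basis vectors of the matrix entry k. *)
Definition ends k : particle v * particle v :=
  let: existT h qp := k in
  (Tagged (fun i => 'I_(v i)) qp.2, Tagged (fun i => 'I_(v i)) qp.1).

Lemma ends_inj : injective ends.
Proof.
case=> h [q p] [h' [q' p']] /= e.
have hh : h = h'.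
  apply: val_inj; rewrite [LHS]surjective_pairing [RHS]surjective_pairing.
  have := congr1 (fun xy : particle v * particle v => (tag xy.1, tag xy.2)) e.
  exact.
case: _ / hh q' p' e => q' p' [].
move=> /eqP; rewrite eq_Tagged /= => /eqP ->.
by move=> /eqP; rewrite eq_Tagged /= => /eqP ->.
Qed.

Lemma card_rep_index (P : particle v -> particle v -> bool) :
  #|[set k : rep_index arr v | P (ends k).1 (ends k).2]| =
  #|[set xy : particle v * particle v |
       arr (tag xy.1) (tag xy.2) && P xy.1 xy.2]|.
Proof.
rewrite -(card_imset _ ends_inj); apply: eq_card => -[[i p] [j q]].
rewrite [in RHS]inE /=; apply/imsetP/andP => [[k]|[aij Pij]].
  rewrite inE => Pk e; move: Pk; rewrite -e /= => Pij; split=> //.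
  case: k e => h [q' p'] e.
  have := congr1 (fun xy : particle v * particle v => (tag xy.1, tag xy.2)) e.
  by case=> -> ->; apply: (valP h).
pose h : arrow arr := exist (fun h : I * I => arr h.1 h.2) (i, j) aij.
by exists (existT _ h (q, p) : rep_index arr v) => //; rewrite inE.
Qed.
End RepDim.

(** * Dimensions of R_{i,a} and of its translates *)

Section RflagCoord.
Variables (K : fieldType) (I : finType) (arr : rel I) (v : I -> nat).
Hypothesis K2 : (2 : K) != 0.
Hypothesis arr_irr : forall i j, arr i j -> i != j.
Variable b : GLfam K v.
Hypothesis hb : inGL b.
Implicit Types (x y : rep K arr v) (k : rep_index arr v).

Lemma ends_neq k : tag (ends k).1 != tag (ends k).2.
Proof. by case: k => h [q p]; apply: arr_irr (valP h). Qed.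

Lemma vcoord_mul x h u (q : 'I_(v (tgt h))) : vcoord b q (x h *m u) =
  \sum_p rcoord b (existT _ h (q, p)) x * vcoord b p u.
Proof.
rewrite /vcoord -{1}[u](mulKVmx (hb (src h))) !mulmxA -mulmxA.
by rewrite mxE.
Qed.

(** A matrix entry from b_p to b_q may be nonzero iff each term of the flag
    that contains b_p contains b_q, that is, iff b_p comes before b_q. *)
Lemma mem_Rflag m (ii : 'I_m -> I) (a : 'I_m -> nat) (F : nat -> gsub K v) x :
  has_weight ii a v -> is_flag b ii a F ->
  x \in Rflag arr m F <-> forall k,
    ~~ (rank (block_word ii a) (ends k).1
          < rank (block_word ii a) (ends k).2)%N ->
    rcoord b k x = 0.
Proof.
move=> hw hF; have Fb : forall l, (l <= m)%N -> bstable b (F l) by case: hF.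
rewrite RflagP; split=> [H k|H l lm h u uF].
  apply: contraNeq => xk; apply/(flag_allowed K2 hb hw hF (ends_neq k)).
  case: k xk => h [q p] xk l lm /= pF.
  apply: (bstable_col K2 hb (Fb l lm) (H l lm h _ pF) (p := q)) => //.
  rewrite vcoord_mul (bigD1 p) //= vcoord_col // eqxx mulr1 big1 ?addr0 //.
  by move=> p' np; rewrite vcoord_col // (negPf np) mulr0.
apply/(bstableP K2 hb (Fb l lm)) => q qF; rewrite vcoord_mul big1 // => p _.
pose k := existT _ h (q, p) : rep_index arr v.
have [pF|pF] := boolP (col p (b (src h)) \in F l (src h)); last first.
  by rewrite (bstableP K2 hb (Fb l lm) u).1 ?mulr0.
rewrite (H k) ?mul0r //; apply: contra qF.
by move/(flag_allowed K2 hb hw hF (ends_neq k)); apply.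
Qed.

Lemma dim_Rflag m (ii : 'I_m -> I) (a : 'I_m -> nat) (F : nat -> gsub K v) :
  has_weight ii a v -> is_flag b ii a F ->
  \dim (Rflag arr m F) = #|edges arr v (block_word ii a)|.
Proof.
move=> hw hF; set t := block_word ii a.
rewrite -(card_rep_index arr (fun x y : particle v => rank t x < rank t y)%N).
apply: (dim_coord_subspace (rcoord_scalar b) (rcoord_inj hb) (rcoord_basis hb)).
move=> x; rewrite (mem_Rflag _ hw hF).
by split=> H k; move: (H k); rewrite inE.
Qed.

Definition rep_weyl (w : weyl v) k : rep_index arr v :=
  let: existT h qp := k in existT _ h (w (tgt h) qp.1, w (src h) qp.2).

Lemma ends_weyl w k :
  ends (rep_weyl w k) = (weyl_act w (ends k).1, weyl_act w (ends k).2).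
Proof. by case: k. Qed.

Lemma rep_weyl_inj w : injective (rep_weyl w).
Proof.
move=> k l /(congr1 (@ends _ _ _)); rewrite !ends_weyl => /eqP.
rewrite xpair_eqE !(inj_eq (@weyl_act_inj _ _ w)) -xpair_eqE => /eqP.
by rewrite -!surjective_pairing => /ends_inj.
Qed.

Section Lift.
Variables (w : weyl v) (g : GLfam K v).
Hypothesis hg : is_lift b w g.

Lemma lift_GL : inGL g.
Proof. by case: hg => -[]. Qed.

(** A lift of w is, in the basis b, a monomial matrix. *)
Lemma lift_in_basis i (p : 'I_(v i)) : exists2 c : K, c != 0 &
  forall r, in_basis b g i r p = c * (r == w i p)%:R.
Proof.
case: hg => _ /(_ i p)[c gp].
have gE r : in_basis b g i r p = c * (r == w i p)%:R.
  have := congr1 (vcoord b r) gp.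
  rewrite [vcoord b r (c *: _)]/vcoord -scalemxAr mxE -/(vcoord b r _).
  rewrite vcoord_col // => <-.
  by rewrite /vcoord /in_basis colE !mulmxA -colE [RHS]mxE.
exists c => //; apply/eqP => c0.
have : col p (b i) = 0.
  by rewrite -[LHS](mulKmx (lift_GL i)) gp c0 scale0r mulmx0.
move/(congr1 (vcoord b p)); rewrite vcoord_col // eqxx /vcoord mulmx0 mxE.
by move/eqP; rewrite oner_eq0.
Qed.

(** Compare the entries at (w q, w p) in y g_src = g_tgt x, where y = g . x. *)
Lemma rcoord_lift k x :
  (rcoord b (rep_weyl w k) (rep_act g x) == 0) = (rcoord b k x == 0).
Proof.
case: k => h [q p].
have [cp cp0 gp] := lift_in_basis p.
have [cq cq0 gq] := lift_in_basis q.
suff e : rcoord b (rep_weyl w (existT _ h (q, p))) (rep_act g x) * cp =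
    cq * rcoord b (existT _ h (q, p)) x.
  have := congr1 (fun z => z == 0) e; rewrite !mulf_eq0 (negPf cp0) (negPf cq0).
  by rewrite orbF.
have comm : (invmx (b (tgt h)) *m rep_act g x h *m b (src h))
      *m in_basis b g (src h)
    = in_basis b g (tgt h) *m (invmx (b (tgt h)) *m x h *m b (src h)).
  rewrite /in_basis ffunE !mulmxA mulmxK // mulmxKV; last exact: lift_GL.
  by rewrite mulmxK.
have := congr1 (fun M : 'M_(_, _) => M (w (tgt h) q) p) comm.
rewrite !mxE (bigD1 (w (src h) p)) //= gp eqxx mulr1 big1 ?addr0; last first.
  by move=> r /negPf nr; rewrite gp nr !mulr0.
rewrite -/(rcoord b (rep_weyl w (existT _ h (q, p))) (rep_act g x)) => ->.
rewrite (bigD1 q) //= gq eqxx mulr1 big1 ?addr0 // => r nrq.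
have [cr _ gr] := lift_in_basis r.
by rewrite gr (inj_eq perm_inj) eq_sym (negPf nrq) mulr0 mul0r.
Qed.

Lemma rep_act_inv y : rep_act g (rep_act (fun i => invmx (g i)) y) = y.
Proof.
apply/ffunP => h; rewrite !ffunE invmxK !mulmxA mulmxV; last exact: lift_GL.
rewrite mul1mx.
by rewrite mulmxK //; apply: lift_GL.
Qed.

Lemma mem_lift_img m (ii : 'I_m -> I) (a : 'I_m -> nat) (F : nat -> gsub K v)
    y :
  has_weight ii a v -> is_flag b ii a F ->
  y \in (linfun (rep_act g) @: Rflag arr m F)%VS <-> forall k,
    ~~ (rank (block_word ii a) (ends k).1
          < rank (block_word ii a) (ends k).2)%N ->
    rcoord b (rep_weyl w k) y = 0.
Proof.
move=> hw hF; split=> [/memv_imgP[x xR ->] k nk|H].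
  rewrite lfunE /=; apply/eqP; rewrite rcoord_lift; apply/eqP.
  exact: (mem_Rflag x hw hF).1.
rewrite -(rep_act_inv y) -[X in X \in _](lfunE (rep_act g)).
apply: memv_img; apply/(mem_Rflag _ hw hF) => k nk.
by apply/eqP; rewrite -rcoord_lift rep_act_inv; apply/eqP/H.
Qed.

Lemma dim_cap_lift m (ii : 'I_m -> I) (a : 'I_m -> nat) (F : nat -> gsub K v)
    m' (ii' : 'I_m' -> I) (a' : 'I_m' -> nat) (F' : nat -> gsub K v) :
  has_weight ii a v -> is_flag b ii a F ->
  has_weight ii' a' v -> is_flag b ii' a' F' ->
  \dim (Rflag arr m F :&: (linfun (rep_act g) @: Rflag arr m' F'))%VS =
  #|common_edges arr (block_word ii a) (block_word ii' a') w|.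
Proof.
move=> hw hF hw' hF'.
set t := block_word ii a; set t' := block_word ii' a'.
rewrite -(card_rep_index arr (fun x y : particle v =>
  (rank t (weyl_act w x) < rank t (weyl_act w y))
  && (rank t' x < rank t' y))%N).
rewrite -(card_imset _ (@rep_weyl_inj w)).
apply: (dim_coord_subspace (rcoord_scalar b) (rcoord_inj hb) (rcoord_basis hb)).
have [wi wiK] : exists wi, cancel wi (rep_weyl w).
  by exists (invF (@rep_weyl_inj w)) => k; apply: f_invF.
move=> y; rewrite memv_cap; split=> [/andP[yR yR'] k|H].
  rewrite -(wiK k) mem_imset ?inE; last exact: rep_weyl_inj.
  rewrite negb_and => /orP[nk|nk].
    by apply: (mem_Rflag y hw hF).1 => //; rewrite ends_weyl.
  by apply: (mem_lift_img y hw' hF').1.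
apply/andP; split.
  apply/(mem_Rflag y hw hF) => k nk; apply: H; apply: contra nk.
  by case/imsetP => l; rewrite inE => /andP[lt _] ->; rewrite ends_weyl.
apply/(mem_lift_img y hw' hF') => k nk; apply: H.
rewrite mem_imset; last exact: rep_weyl_inj.
by rewrite inE negb_and nk orbT.
Qed.

End Lift.
End RflagCoord.

(** * The Cartan matrix and the product formula *)

Section Cartan.
Variables (R : realType) (n : nat) (Phi : seq 'rV[R]_n) (I : finType).
Variable e : I -> 'rV[R]_n.
Hypotheses (hPhi : root_system Phi) (he : simple_roots Phi e).
Hypothesis hADE : simply_laced e.

Lemma dotvC (x y : 'rV[R]_n) : dotv x y = dotv y x.
Proof. by rewrite /dotv !mxE; apply: eq_bigr => k _; rewrite !mxE mulrC. Qed.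

Lemma dotv_eq0 (x : 'rV[R]_n) : (dotv x x == 0) = (x == 0).
Proof.
apply/eqP/eqP => [|->]; last by rewrite /dotv mul0mx mxE.
rewrite /dotv mxE => /eqP; rewrite psumr_eq0; last first.
  by move=> k _; rewrite !mxE -expr2 sqr_ge0.
move/allP => x0; apply/rowP => k; rewrite [RHS]mxE.
have := x0 k (mem_index_enum _).
by rewrite !mxE mulf_eq0 orbb => /eqP.
Qed.

Lemma dotv_simple i : dotv (e i) (e i) != 0.
Proof.
case: hPhi => n0 _ _ _ _; case: he => eP _ _.
by rewrite dotv_eq0; apply: contraNneq n0 => <-.
Qed.

Lemma cartan_diag i : cartan e i i = 2.
Proof.
by rewrite /cartan /copair mulfK ?dotv_simple // -[2]/(2%:~R) intrKfloor.
Qed.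

Lemma copair_eq0_sym i j : copair (e i) (e j) = 0 -> copair (e j) (e i) = 0.
Proof.
rewrite /copair => /eqP; rewrite !mulf_eq0 invr_eq0.
rewrite (negPf (dotv_simple j)) orbF dotvC.
by case/orP => /eqP->; rewrite ?mulr0 !mul0r.
Qed.

(** Off the diagonal the entries are 0 or -1, and symmetric; an entry -1 is
    witnessed by exactly one of the two possible arrows. *)
Lemma cartan_arrows (arr : rel I) : is_orientation (cartan e) arr ->
  forall i j, cartan e i j = (2 * (i == j))%:Z - (arr i j)%:Z - (arr j i)%:Z.
Proof.
move=> [arrE arrX] i j.
have c0 k l : copair (e k) (e l) = 0 -> cartan e k l = 0.
  by rewrite /cartan => ->; rewrite floor0.
have c1 k l : copair (e k) (e l) = -1 -> cartan e k l = -1.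
  by rewrite /cartan => ->; rewrite -[-1]/((-1)%:~R) intrKfloor.
have [<-|nij] := eqVneq i j.
  rewrite cartan_diag; case a : (arr i i) => //=.
  by have := arrE _ _ a; rewrite cartan_diag.
case: (hADE nij) => ce.
  have a1 : arr i j = false by apply/negP => /arrE; rewrite c0.
  have a2 : arr j i = false.
    by apply/negP => /arrE; rewrite c0 // copair_eq0_sym.
  by rewrite a1 a2 c0.
have := arrX _ _ (c1 _ _ ce); rewrite c1 //.
by case: (arr i j); case: (arr j i).
Qed.

End Cartan.

Lemma Emon_word (I : finType) (U : algType Qv) (E : I -> U) m
    (ii : 'I_m -> I) a :
  Emon E ii a = (\prod_(k < m) qfact (a k))^-1 *: word E (block_word ii a).
Proof.
rewrite /Emon /divpow scaler_prod prodfV; congr (_ *: _).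
rewrite /word /block_word big_flatten big_map enumT [index_enum _]unlock.
by apply: eq_bigr => k _; rewrite big_nseq iter_mulr_1.
Qed.

Lemma sum_count_mem (I : finType) (t : seq I) :
  (\sum_i count_mem i t = size t)%N.
Proof.
elim: t => [|x t IH] /=; first by rewrite big1.
rewrite big_split /= IH (bigD1 x) //= eqxx big1 // => i.
by rewrite eq_sym => /negPf->.
Qed.

Theorem corollary4p10
  (R : realType)
  (* root system *)
  (n : nat) (Phi : seq 'rV[R]_n) (I : finType) (e : I -> 'rV[R]_n)
  (hPhi : root_system Phi) (he : simple_roots Phi e) (hADE : simply_laced e)
  (* U^+, its twisted tensor square, and the bilinear form *)
  (U : algType Qv) (E : I -> U) (hU : is_Uplus (cartan e) E)
  (UU : algType Qv) (tens : {bilinear U -> U -> UU})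
  (htens : is_tensor tens) (hmul : twisted_mul (cartan e) E tens)
  (r : {lrmorphism U -> UU})
  (hr : forall i, r (E i) = tens (E i) 1 + tens 1 (E i))
  (form : {biscalar U}) (hform : lusztig_form E tens r form)
  (* quiver, and (B, T) *)
  (arr : rel I) (harr : is_orientation (cartan e) arr)
  (v : I -> nat) (b : GLfam R[i] v) (hb : inGL b)
  (* the two pairs, with their B-stable flags *)
  (m m' : nat) (ii : 'I_m -> I) (a : 'I_m -> nat)
  (ii' : 'I_m' -> I) (a' : 'I_m' -> nat)
  (hw : has_weight ii a v) (hw' : has_weight ii' a' v)
  (F F' : nat -> gsub R[i] v)
  (hF : is_flag b ii a F) (hF' : is_flag b ii' a' F')
  (* lifts of the elements of the Weyl group *)
  (wd : weyl v -> GLfam R[i] v) (hwd : forall w, is_lift b w (wd w)) :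
  let RF := Rflag arr m F in
  let RF' := Rflag arr m' F' in
  form (Emon E ii a) (Emon E ii' a') =
    vv ^ (- (\dim RF)%:Z - (\dim RF')%:Z)
    * ((\prod_i (1 - vv ^- 2) ^- v i)
       / ((\prod_(k < m) qfact (a k)) * \prod_(k < m') qfact (a' k)))
    * \sum_(w : weyl v)
        vv ^+ (2 * (weyl_length w
                    + \dim (RF :&: (linfun (rep_act (wd w)) @: RF')))).
Proof.
move=> RF RF'.
have K2 : (2 : R[i]) != 0 by rewrite pnatr_eq0.
have cE := cartan_arrows hPhi he hADE harr.
have arr_irr i j : arr i j -> i != j.
  by move/harr.1; apply: contra_eqN => /eqP->; rewrite (cartan_diag hPhi he).
set t := block_word ii a; set t' := block_word ii' a'.
have ht i : count_mem i t = v i by rewrite count_block_word -hw.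
have ht' i : count_mem i t' = v i by rewrite count_block_word -hw'.
rewrite !Emon_word -/t -/t' linearZl_LR linearZr_LR /=.
have := form_word_permutations hmul hr hform tag t' (particles_sorted ht).
rewrite tag_particles // => ->.
rewrite sum_permutations_act //.
have normE : gen_norm ^+ size t' = \prod_i (1 - vv ^- 2) ^- v i.
  rewrite -sum_count_mem (eq_bigr v) // prodfV prodrXr.
  by rewrite -exprVn.
rewrite normE.
have sumE : \sum_w vv ^ inv_weight (cartan e) tag (rank t)
      [seq weyl_act w x | x <- particles v t'] =
   vv ^ (- (\dim RF)%:Z - (\dim RF')%:Z) * \sum_(w : weyl v)
        vv ^+ (2 * (weyl_length w
                    + \dim (RF :&: (linfun (rep_act (wd w)) @: RF')))).
  rewrite mulr_sumr; apply: eq_bigr => w _.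
  rewrite (inv_weight_act cE arr_irr ht ht') exprnP -expfzDr ?vv_neq0 //.
  rewrite weyl_length_ninv (dim_Rflag K2 arr_irr hb hw hF).
  rewrite (dim_Rflag K2 arr_irr hb hw' hF').
  rewrite (dim_cap_lift K2 arr_irr hb (hwd w) hw hF hw' hF').
  by congr (vv ^ _); rewrite -/t -/t' PoszM [RHS]addrC addrA.
have shuffle (x y g p z : Qv) : x * (y * (g * (p * z))) = p * (g * (x * y)) * z.
  rewrite mulrCA mulrA !(mulrCA _ p) -!mulrA.
  by rewrite (mulrCA x g) (mulrCA y g) (mulrCA y x).
by rewrite sumE shuffle (invfM (\prod_(k < m) _)).
Qed.
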